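(* Let $X$ be a complete separable Riemannian manifold and $Y$ a Polish space, equipped with Borel probability measures $\mu$ on $X$ and $\nu$ on $Y$. Let $c : X \times Y \to \mathbb{R}$ be a bounded continuous cost function and let $m\in\mathbb{N}$. Assume that: (1) $c$ satisfies the $m$-twist condition; (2) $\mu$ is non-atomic and any $c$-concave function is differentiable $\mu$-almost surely on its domain. Then for each optimal plan $\gamma$ of the Kantorovich problem $\inf\{\int_{X\times Y} c\,d\pi : \pi\in\Pi(\mu,\nu)\}$, there exist $k\in\{1,\dots,m\}$, a sequence $\{\alpha_i\}_{i=1}^k$ of non-negative measurable functions from $X$ to $[0,1]$, and Borel measurable maps $G_1,\dots,G_k$ from $X$ to $Y$ such that $$\gamma=\sum_{i=1}^k \alpha_i\,(\mathrm{Id}\times G_i)_\#\mu,$$ where $\sum_{i=1}^k\alpha_i(x)=1$ for $\mu$-almost every $x\in X$.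
   Context: $\Pi(\mu,\nu)$ is the set of Borel probability measures on $X\times Y$ with marginals $\mu$ and $\nu$. An optimal plan is a $\gamma\in\Pi(\mu,\nu)$ attaining $\inf\{\int_{X\times Y} c\,d\pi : \pi\in\Pi(\mu,\nu)\}$. $m$-twist condition: $x\mapsto c(x,y)$ is differentiable for all $y\in Y$, and for any $x_0\in X$, $y_0\in Y$ the set $\{y\in Y : \frac{\partial c(x_0,y)}{\partial x}=\frac{\partial c(x_0,y_0)}{\partial x}\}$ has cardinality at most $m$. A function $\varphi:X\to\mathbb{R}\cup\{-\infty\}$, not identically $-\infty$, is $c$-concave if $\varphi(x)=\inf_{y\in Y}[c(x,y)-\psi(y)]$ for some $\psi:Y\to\mathbb{R}\cup\{\pm\infty\}$; its domain is the set where it is finite. The notation $\gamma=\sum_{i=1}^k \alpha_i(\mathrm{Id}\times G_i)_\#\mu$ means that $\gamma(S)=\sum_{i=1}^k\int_X\alpha_i(x)\chi_S(x,G_i(x))\,d\mu(x)$ for every measurable $S\subset X\times Y$, where $\chi_S$ is the indicator function of $S$. *)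

(* Defs.v *)
From HB Require Import structures.
From mathcomp Require Import all_boot all_order all_algebra.
From mathcomp Require Import all_classical all_reals all_analysis.

Set Implicit Arguments.
Unset Strict Implicit.
Unset Printing Implicit Defensive.

Import Order.TTheory GRing.Theory Num.Theory.
Import numFieldNormedType.Exports.

Local Open Scope classical_set_scope.
Local Open Scope ring_scope.

Section topology.
Context {R : realType} {T : topologicalType}.

Definition separable := exists2 D : set T, countable D & dense D.

(* Distances are extended-real valued: the Riemannian distance between two
   connected components is +oo. *)
Definition cauchy_sequence (d : T -> T -> \bar R) (u : nat -> T) :=
  forall e : R, 0 < e ->
    exists N, forall p q, (N <= p)%N -> (N <= q)%N -> (d (u p) (u q) < e%:E)%E.

Definition complete_distance (d : T -> T -> \bar R) :=
  forall u : nat -> T, cauchy_sequence d u -> exists l : T, u @ \oo --> l.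

Definition is_metric (d : T -> T -> R) :=
  [/\ forall x y, 0 <= d x y,
      forall x y, d x y = 0 <-> x = y,
      forall x y, d x y = d y x &
      forall x y z, d x z <= d x y + d y z].

Definition metrizes_topology (d : T -> T -> R) :=
  forall (x : T) (A : set T),
    nbhs x A <-> exists2 e : R, 0 < e & [set y | d x y < e] `<=` A.

End topology.

Arguments separable : clear implicits.

Definition polish_space (R : realType) (T : topologicalType) :=
  separable T /\
  exists d : T -> T -> R,
    [/\ is_metric d, metrizes_topology d &
        complete_distance (fun x y => (d x y)%:E)].

Notation borel T := (g_sigma_algebraType (@open T)).

Section smooth_maps.
Context {R : realType} {V W : normedModType R}.

Fixpoint Ck_on (k : nat) (U : set V) (f : V -> W) : Prop :=
  match k with
  | 0 => {in U, continuous f}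
  | k'.+1 => (forall x, U x -> differentiable f x) /\
             (forall v : V, Ck_on k' U (fun x => 'D_v f x))
  end.

Definition smooth_on (U : set V) (f : V -> W) := forall k, Ck_on k U f.

End smooth_maps.

(* [chart_map] and [chart_inv] are total functions, meaningful only on
   [chart_dom] and on [chart_map @` chart_dom] respectively. *)
Record chart (R : realType) (n : nat) (M : topologicalType) := Chart {
  chart_dom : set M ;
  chart_map :> M -> 'rV[R]_n ;
  chart_inv : 'rV[R]_n -> M ;
  chart_dom_open : open chart_dom ;
  chart_codom_open : open (chart_map @` chart_dom) ;
  chart_mapK : {in chart_dom, cancel chart_map chart_inv} ;
  chart_map_continuous : {in chart_dom, continuous chart_map} ;
  chart_inv_continuous : {in chart_map @` chart_dom, continuous chart_inv}
}.

Record smooth_atlas (R : realType) (n : nat) (M : topologicalType) :=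
  SmoothAtlas {
  atlas : set (chart R n M) ;
  chart_at : M -> chart R n M ;
  chart_at_atlas : forall x, atlas (chart_at x) ;
  chart_at_dom : forall x, chart_dom (chart_at x) x ;
  atlas_compatible : forall e e', atlas e -> atlas e' ->
    smooth_on (e @` (chart_dom e `&` chart_dom e')) (e' \o chart_inv e)
}.

Section manifold_differential.
Context {R : realType} {n : nat} {M : topologicalType}.
Variable S : smooth_atlas R n M.

Definition mdifferentiable (f : M -> R) (x : M) : Prop :=
  differentiable (f \o chart_inv (chart_at S x)) (chart_at S x x).

(* The differential of [f] at [x], an element of the cotangent space at [x]
   written in the coordinates of the chart [chart_at S x]. *)
Definition mdiff (f : M -> R) (x : M) : 'rV[R]_n -> R :=
  'd (f \o chart_inv (chart_at S x)) (chart_at S x x).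

Definition emdifferentiable (f : M -> \bar R) (x : M) : Prop :=
  (\forall z \near x, f z \is a fin_num) /\ mdifferentiable (fine \o f) x.

End manifold_differential.

Definition mx_form (R : realType) (n : nat) (B : 'M[R]_n) (v w : 'rV[R]_n) : R :=
  (v *m B *m w^T) 0 0.

(* [metric_mx e x] is the matrix (g_ij(x)) in the coordinates of the chart
   [e]; it is meaningful only for [e] in the atlas and [x] in its domain. *)
Record riemannian_metric (R : realType) (n : nat) (M : topologicalType)
    (S : smooth_atlas R n M) := RiemannianMetric {
  metric_mx : chart R n M -> M -> 'M[R]_n ;
  metric_mx_sym : forall e x, atlas S e -> chart_dom e x ->
    (metric_mx e x)^T = metric_mx e x ;
  metric_mx_posdef : forall e x v, atlas S e -> chart_dom e x -> v != 0 ->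
    0 < mx_form (metric_mx e x) v v ;
  metric_mx_smooth : forall e i j, atlas S e ->
    smooth_on (e @` chart_dom e) (fun z => metric_mx e (chart_inv e z) i j) ;
  metric_mx_compatible : forall e e' x v w, atlas S e -> atlas S e' ->
    chart_dom e x -> chart_dom e' x ->
    mx_form (metric_mx e' x) ('d (e' \o chart_inv e) (e x) v)
                             ('d (e' \o chart_inv e) (e x) w)
    = mx_form (metric_mx e x) v w
}.

Section riemannian_distance.
Context {R : realType} {n : nat} {M : topologicalType}.
Context {S : smooth_atlas R n M}.
Variable g : riemannian_metric S.

Definition C1_curve_on (U : set R) (z : R -> M) :=
  forall t, U t -> {for t, continuous z} /\
    forall e, atlas S e -> chart_dom e (z t) ->
      derivable (e \o z) t 1 /\ {for t, continuous (derive1 (e \o z))}.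

(* On each closed piece of the partition, the curve is the restriction of a C^1
   curve defined on an open neighbourhood of that piece. *)
Definition piecewise_C1_curve (z : R -> M) :=
  exists2 s : seq R, itv_partition 0 1 s &
    forall i, (i < size s)%N ->
      exists U : set R, exists zi : R -> M,
        [/\ open U, `[nth 0 (0 :: s) i, nth 0 s i]%classic `<=` U,
            C1_curve_on U zi &
            forall t, nth 0 (0 :: s) i <= t <= nth 0 s i -> z t = zi t].

Definition curve_speed (z : R -> M) (t : R) : R :=
  let e := chart_at S (z t) in
  let v := derive1 (e \o z) t in
  Num.sqrt (mx_form (metric_mx g e (z t)) v v).

Definition curve_length (z : R -> M) : \bar R :=
  (\int[lebesgue_measure]_(t in `[0%R, 1%R]) (curve_speed z t)%:E)%E.

Definition riemannian_distance (x y : M) : \bar R :=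
  ereal_inf [set l | exists z : R -> M,
    [/\ piecewise_C1_curve z, z 0 = x, z 1 = y & l = curve_length z]].

End riemannian_distance.

(* A Hausdorff separable space carrying a Riemannian metric is automatically
   second countable. *)
Definition complete_separable_riemannian (R : realType) (n : nat)
    (M : topologicalType) (S : smooth_atlas R n M) (g : riemannian_metric S) :=
  [/\ hausdorff_space M, separable M &
      complete_distance (riemannian_distance g)].

Definition non_atomic (d : measure_display) (T : measurableType d)
    (R : realType) (mu : {measure set T -> \bar R}) :=
  forall A, measurable A -> (0 < mu A)%E ->
    exists B, [/\ measurable B, B `<=` A & (0 < mu B < mu A)%E].

Section transport.
Context {R : realType} {X Y : ptopologicalType}.

Definition couplings (mu : probability (borel X) R)
    (nu : probability (borel Y) R) : set (probability (borel (X * Y)%type) R) :=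
  [set p | (forall A : set (borel X), measurable A ->
              p [set z | A z.1] = mu A) /\
           (forall B : set (borel Y), measurable B ->
              p [set z | B z.2] = nu B)].

Definition transport_cost (c : X * Y -> R)
    (p : probability (borel (X * Y)%type) R) : \bar R :=
  (\int[p]_z (c z)%:E)%E.

Definition optimal_plan (c : X * Y -> R) (mu : probability (borel X) R)
    (nu : probability (borel Y) R) (p : probability (borel (X * Y)%type) R) :=
  couplings mu nu p /\
  transport_cost c p = ereal_inf (transport_cost c @` couplings mu nu).

Definition c_concave (c : X * Y -> R) (phi : X -> \bar R) :=
  [/\ forall x, phi x != +oo%E,
      exists x, phi x != -oo%E &
      exists psi : Y -> \bar R, forall x,
        phi x = ereal_inf (range (fun y => (c (x, y))%:E - psi y)%E)].

Definition m_twist (n : nat) (S : smooth_atlas R n X) (c : X * Y -> R)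
    (m : nat) :=
  (forall y x, mdifferentiable S (fun x' => c (x', y)) x) /\
  (forall x0 y0,
    ([set y | mdiff S (fun x => c (x, y)) x0 = mdiff S (fun x => c (x, y0)) x0]
       #<= `I_m)%card).

End transport.

(* Main.v *)
Require Import Defs.
From HB Require Import structures.
From mathcomp Require Import all_boot all_order all_algebra.
From mathcomp Require Import all_classical all_reals all_analysis.
From mathcomp Require Import measurable_realfun lra ring.

Set Implicit Arguments.
Unset Strict Implicit.
Unset Printing Implicit Defensive.

Import Order.TTheory GRing.Theory Num.Theory.
Import numFieldNormedType.Exports.

Local Open Scope classical_set_scope.
Local Open Scope ring_scope.

(** An optimal plan is concentrated on a c-cyclically monotone set: otherwise
    mass could be exchanged, through products of marginals, along a cycle of
    small rectangles.  Since [Y] is second countable, rectangles whose first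
    factor is an interval condition on [c (., y)] suffice, and no countable
    base of [X] is needed.  Rockafellar's construction gives a real-valued
    c-concave potential [phi] whose c-superdifferential [K] is closed and has
    full measure.  Where [phi] is differentiable, every [y] with [(x, y)] in
    [K] satisfies d_x c (x, y) = d phi (x), so the m-twist condition leaves at
    most [m] such [y].  As the second marginal is tight, [K] may be cut down to
    a sigma-compact part of [Y], along which projections of closed sets are
    Borel; this yields Borel maps [G_i] whose graphs cover [K] up to a null
    set.  The weights [alpha_i] are the Radon-Nikodym densities of the first
    marginals of [gamma] restricted to the disjointified graphs. *)

(** * Polish spaces *)

(* The sets [V k] need not be open. *)
Definition network (T : topologicalType) (V : nat -> set T) :=
  forall (U : set T) y, open U -> U y -> exists k, V k y /\ V k `<=` U.

Section metrizable.
Context {R : realType} {Y : ptopologicalType}.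
Variable d : Y -> Y -> R.
Hypotheses (dm : is_metric d) (dtop : metrizes_topology d).

Definition closed_ball_for (x : Y) (e : R) : set Y := [set y | d x y <= e].

Lemma closed_ball_for_closed x e : closed (closed_ball_for x e).
Proof.
case: dm => d0 deq dC dtri.
rewrite -openC openE => y /=; rewrite /closed_ball_for /= => /negP.
rewrite -ltNge => exy; apply/dtop; exists (d x y - e);
  first by rewrite subr_gt0.
move=> z /= yz /=; apply/negP; rewrite -ltNge.
have := dtri x z y; rewrite (dC z y); lra.
Qed.

Lemma metrizable_hausdorff : hausdorff_space Y.
Proof.
case: dm => d0 deq dC dtri.
move=> x y xy; apply/deq/eqP/negPn/negP => dxy.
have e0 : 0 < d x y / 2 by rewrite divr_gt0// lt_def dxy d0.
have nx z : nbhs z [set t | d z t < d x y / 2] by apply/dtop;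
  exists (d x y / 2).
have [z /= [xz yz]] := xy _ _ (nx x) (nx y).
by have := dtri x z y; rewrite (dC z y); lra.
Qed.

Lemma separable_dense_sequence : separable Y ->
  exists u : nat -> Y, forall (y : Y) (e : R), 0 < e -> exists k, d (u k) y < e.
Proof.
case: dm => d0 deq dC dtri.
move=> [D cD dD].
have [a Da] : D !=set0.
  have [a [_ Da]] := dD setT (ex_intro _ point I) openT; by exists a.
have [u uD] : exists u : nat -> Y, D `<=` range u.
  have /countable_injP[f finj] := cD.
  exists (fun n => xget a [set z | D z /\ f z = n]) => z Dz.
  exists (f z) => //; case: xgetP => [t _ [Dt]|/(_ z)/=]; last by case.
  by apply: finj; rewrite inE.
exists u => y e e0.
have ny : nbhs y [set t | d y t < e] by apply/dtop; exists e.
have [z [/interior_subset /= yz Dz]] := dD _ (ex_intro _ y ny) (open_interior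
  _).
by have [k _ uk] := uD _ Dz; exists k; rewrite uk dC.
Qed.

(** Closed balls of radius [1 / (j + 1)] around a dense sequence. Closed members are what the later
    projection arguments along compact sets use. *)
Lemma separable_closed_network : separable Y ->
  exists V : nat -> set Y, (forall k, closed (V k)) /\ network V.
Proof.
case: (dm) => d0 deq dC dtri.
move=> /separable_dense_sequence[u udense].
pose V k : set Y := if @unpickle (nat * nat)%type k is Some ij then
  closed_ball_for (u ij.1) (ij.2.+1%:R^-1) else set0.
exists V; split.
  by move=> k; rewrite /V; case: unpickle => [ij|];
    [exact: closed_ball_for_closed|exact: closed0].
move=> U y oU Uy.
have [e e0 eU] : exists2 e, 0 < e & [set z | d y z < e] `<=` U.
  by apply/dtop; exact: open_nbhs_nbhs.
have [j ej] : exists j, j.+1%:R^-1 < e / 2.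
  have e20 : 0 < e / 2 by rewrite divr_gt0.
  have [j _ /(_ j (leqnn _)) ?] := near_infty_natSinv_lt (PosNum e20).
  by exists j.
have [i ui] := udense y (j.+1%:R^-1) (ltac:(by rewrite invr_gt0)).
exists (pickle (i, j)); rewrite /V pickleK /=; split; first exact: ltW.
move=> z /= uz; apply: eU => /=.
move: (dtri y (u i) z) ej ui uz; rewrite (dC y (u i)) /closed_ball_for /=.
by move: (j.+1%:R^-1) => w; lra.
Qed.

(** An ultrafilter containing [F] contains a closed ball of every radius [1 / (n + 1)]. Points
    picked in the finite intersections of these balls form a Cauchy sequence, and its limit is a
    limit of the ultrafilter. *)
Lemma totally_bounded_compact (F : set Y) :
  complete_distance (fun x y => (d x y)%:E) -> closed F ->
  (forall e : R, 0 < e -> exists s : seq Y,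
     forall y, F y -> exists2 x, x \in s & d x y <= e) ->
  compact F.
Proof.
case: dm => d0 deq dC dtri.
move=> compl cF tb; rewrite compact_ultra => U UU UF.
have ball (e : R) : 0 < e -> exists x, U (closed_ball_for x e).
  move=> /tb[s sF].
  have : U [set y | exists2 x, x \in s & d x y <= e] by apply: filterS UF.
  elim: s {sF} => [|x s IH] Us; first by have [? [?]] := filter_ex Us.
  have [?|Unx] := in_ultra_setVsetC (closed_ball_for x e) UU; first by exists x.
  apply: IH; apply: filterS (filterI Us Unx) => y [[z]].
  rewrite inE => /predU1P[->//|zs zy _]; by exists z.
have /choice[x Ux] : forall n : nat, exists x, U (closed_ball_for x n.+1%:R^-1).
  by move=> n; apply: ball; rewrite invr_gt0.
have UI n : U (F `&` \bigcap_(i in `I_n.+1) closed_ball_for (x i) i.+1%:R^-1).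
  apply: filterI => //; elim: n => [|n IH].
    by apply: filterS (Ux 0) => y xy i /=; rewrite ltnS leqn0 => /eqP ->.
  apply: filterS (filterI IH (Ux n.+1)) => y [yn y1] i /=.
  by rewrite ltnS leq_eqVlt => /predU1P[->//|]; exact: yn.
have [u Hu] := choice (fun n => filter_ex (UI n)).
have close N n : (N <= n)%N -> d (x N) (u n) <= N.+1%:R^-1.
  by move=> Nn; have [_] := Hu n; apply; rewrite /= ltnS.
have half (e : R) : 0 < e -> exists N : nat, N.+1%:R^-1 < e / 2.
  move=> e0; have e20 : 0 < e / 2 by rewrite divr_gt0.
  have [N _ /(_ N (leqnn _)) ?] := near_infty_natSinv_lt (PosNum e20).
  by exists N.
have cauchy : cauchy_sequence (fun x y => (d x y)%:E) u.
  move=> e /half[N Ne]; exists N => p q Np Nq; rewrite lte_fin.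
  move: (dtri (u p) (x N) (u q)) (close _ _ Np) (close _ _ Nq) Ne.
  by rewrite (dC (u p) (x N)); move: (N.+1%:R^-1) => w; lra.
have [l ul] := compl _ cauchy.
have Fl : F l.
  apply: (@closed_cvg _ _ \oo _ u F cF _ _ ul); apply: nearW => n;
    by have [] := Hu n.
exists l; split => // A /dtop[e e0 eA].
have [N Ne] := half (e / 2) (ltac:(by rewrite divr_gt0)).
apply: filterS (Ux N) => y xy; apply: eA => /=.
have [n Nn ln] : exists2 n, (N <= n)%N & d l (u n) < e / 2.
  have nl : nbhs l [set t | d l t < e / 2] by apply/dtop; exists (e / 2);
    rewrite ?divr_gt0.
  have /= [M _ HM] := ul _ nl.
  by exists (maxn M N); [rewrite leq_maxr|apply: HM; rewrite /= leq_maxl].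
move: (close _ _ Nn) (dtri l (u n) (x N)) (dtri l (x N) y) Ne xy.
by rewrite (dC (u n)) /closed_ball_for /=; move: (N.+1%:R^-1) => w; lra.
Qed.

End metrizable.

(** * Borel sets of products *)

HB.instance Definition _ (X Y : ptopologicalType) := Pointed.on (X * Y)%type.

Section borel.
Context {R : realType}.

Lemma open_measurable_borel (T : ptopologicalType) (U : set T) :
  open U -> measurable (U : set (borel T)).
Proof. by move=> oU; exact: sub_sigma_algebra. Qed.

Lemma closed_measurable_borel (T : ptopologicalType) (C : set T) :
  closed C -> measurable (C : set (borel T)).
Proof.
by rewrite -openC => /open_measurable_borel /measurableC; rewrite setCK.
Qed.

Lemma measurable_fun_borel (d : measure_display) (S : measurableType d)
    (T : ptopologicalType) (f : S -> T) :
  (forall U, open U -> measurable (f @^-1` U)) ->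
  measurable_fun [set: S] (f : S -> borel T).
Proof.
move=> fU; apply: (@measurability _ _ S (borel T) setT f (@open T)) => //.
by move=> _ [U oU <-]; rewrite setTI; exact: fU.
Qed.

Lemma continuous_measurable_borel (T U : ptopologicalType) (f : T -> U) :
  continuous f -> measurable_fun [set: borel T] (f : borel T -> borel U).
Proof.
move=> cf; apply: measurable_fun_borel => V oV; apply: open_measurable_borel.
by apply: open_comp => // x _; exact: cf.
Qed.

Lemma continuous_measurable_borelR (T : ptopologicalType) (f : T -> R) :
  continuous f -> measurable_fun [set: borel T] (f : borel T -> R).
Proof.
move=> cf; apply: (measurability _ (measurable_realfun.RGenOpens.measurableE
  R)).
move=> _ [V [a [b ->]] <-]; rewrite setTI; apply: open_measurable_borel.
apply: open_comp; [by move=> x _; exact: cf|exact: interval_open].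
Qed.

Lemma network_bigcup (T : topologicalType) (V : nat -> set T) (U : set T) :
  network V -> open U -> U = \bigcup_(k in [set k | V k `<=` U]) V k.
Proof.
move=> nV oU; apply/seteqP; split=> [y Uy|y [k VU Vy]]; last exact: VU.
by have [k [Vy VU]] := nV _ _ oU Uy; exists k.
Qed.

Lemma network_separates (T : topologicalType) (V : nat -> set T) (y y' : T) :
  network V -> hausdorff_space T -> y <> y' ->
  exists k l, [/\ V k y, V l y' & V k `&` V l = set0].
Proof.
move=> nV; rewrite open_hausdorff => hT /eqP/hT[[A A'] /=].
move=> [/set_mem Ay /set_mem Ay'] [oA oA' /eqP AA'].
have [k [Vk kA]] := nV _ _ oA Ay; have [l [Vl lA']] := nV _ _ oA' Ay'.
by exists k, l; split => //; rewrite -subset0 -AA'; exact: setISS.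
Qed.

Lemma measurable_fun_network (d : measure_display) (S : measurableType d)
    (T : ptopologicalType) (V : nat -> set T) (f : S -> T) :
  network V -> (forall k, measurable (f @^-1` V k)) ->
  measurable_fun [set: S] (f : S -> borel T).
Proof.
move=> nV fV; apply: measurable_fun_borel => U /(network_bigcup nV) ->.
by rewrite preimage_bigcup; exact: bigcup_measurable.
Qed.

(** [U k] is the largest open set whose product with [V k] stays inside [A]. Countability is drawn
    from the second factor only. *)
Lemma open_prod_bigcup (S T : topologicalType) (V : nat -> set T)
    (A : set (S * T)) : network V -> open A ->
  exists U : nat -> set S, (forall k, open (U k)) /\
    A = \bigcup_k [set z | U k z.1 /\ V k z.2].
Proof.
move=> nV oA.
exists (fun k => interior [set x | forall y, V k y -> A (x, y)]).
split; first by move=> k; exact: open_interior.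
apply/seteqP; split=> [[x y] Axy|[x y] [k _ [/= /interior_subset /= Ux Vy]]].
  have : nbhs (x, y) A by exact: open_nbhs_nbhs.
  move=> [[P Q] /= [Px Qy] PQA].
  have [k [Vy VQ]] := nV _ _ (open_interior Q) Qy.
  exists k => //; split => //=; rewrite /interior;
    apply: filterS Px => x' Px' y' /VQ/interior_subset Qy'.
  exact: PQA.
exact: Ux.
Qed.

Lemma measurable_fun_pair_borel (d : measure_display) (S : measurableType d)
    (X Y : ptopologicalType) (V : nat -> set Y) (f : S -> X) (g : S -> Y) :
  network V -> (forall k, closed (V k)) ->
  measurable_fun [set: S] (f : S -> borel X) ->
  measurable_fun [set: S] (g : S -> borel Y) ->
  measurable_fun [set: S] ((fun s => (f s, g s)) : S -> borel (X * Y)%type).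
Proof.
move=> nV cV mf mg; apply: (@measurable_fun_borel _ S (X * Y)%type) => A
  /(open_prod_bigcup nV).
move=> [U [oU ->]]; rewrite preimage_bigcup; apply: bigcup_measurable => k _.
rewrite (_ : _ @^-1` _ = f @^-1` U k `&` g @^-1` V k)//.
apply: measurableI; rewrite -[_ @^-1` _]setTI; [apply: mf|apply: mg] => //.
  exact: open_measurable_borel.
exact: closed_measurable_borel.
Qed.

Section product.
Context {X Y : ptopologicalType}.

Lemma measurable_fst_borel :
  measurable_fun [set: borel (X * Y)%type] (fst : borel (X * Y)%type -> borel
    X).
Proof. by apply: continuous_measurable_borel => z; exact: cvg_fst. Qed.

Lemma measurable_snd_borel :
  measurable_fun [set: borel (X * Y)%type] (snd : borel (X * Y)%type -> borel
    Y).
Proof. by apply: continuous_measurable_borel => z; exact: cvg_snd. Qed.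

Lemma measurable_fst_preimage (A : set (borel X)) : measurable A ->
  measurable ([set z | A z.1] : set (borel (X * Y)%type)).
Proof. by move=> mA; have := measurable_fst_borel measurableT mA;
  rewrite setTI. Qed.

Lemma measurable_snd_preimage (B : set (borel Y)) : measurable B ->
  measurable ([set z | B z.2] : set (borel (X * Y)%type)).
Proof. by move=> mB; have := measurable_snd_borel measurableT mB;
  rewrite setTI. Qed.

Lemma measurable_setX_borel (A : set (borel X)) (B : set (borel Y)) :
  measurable A -> measurable B ->
  measurable (A `*` B : set (borel (X * Y)%type)).
Proof.
move=> mA mB; apply: measurableI.
  exact: measurable_fst_preimage.
exact: measurable_snd_preimage.
Qed.

(** A point lies off the graph exactly when two disjoint network members separate [G x] from [y], so
    the complement is a countable union of Borel rectangles. *)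
Lemma measurable_graph (V : nat -> set Y) (G : X -> Y) :
  network V -> (forall k, closed (V k)) -> hausdorff_space Y ->
  measurable_fun [set: borel X] (G : borel X -> borel Y) ->
  measurable ([set z | G z.1 = z.2] : set (borel (X * Y)%type)).
Proof.
move=> nV cV hY mG.
rewrite (_ : [set _ | _] = ~` \bigcup_k \bigcup_(l in [set l | V k `&` V l =
  set0])
  ((G @^-1` V k) `*` V l)).
  apply: measurableC; apply: bigcup_measurable => k _.
  apply: bigcup_measurable => l _; apply: measurable_setX_borel.
    rewrite -[_ @^-1` _]setTI; apply: mG => //; exact: closed_measurable_borel.
  exact: closed_measurable_borel.
apply/seteqP; split=> [[x y] /= <- [k _ [l /= kl [/= Gk Gl]]]|[x y] /= nxy].
  by have : (V k `&` V l) (G x) by []; rewrite kl.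
apply: contrapT => /(network_separates nV hY)[k [l [Vk Vl kl]]].
by apply: nxy; exists k => //; exists l.
Qed.

End product.

End borel.

(** * Tightness of probability measures on Polish spaces *)

(** For each [l], finitely many balls of radius [1 / (l + 1)] cover all but a mass
    [2^-(l+1) / (n + 1)]. Intersecting over [l] gives a closed totally bounded set [F n] that misses
    at most [1 / (n + 1)]. *)
Lemma probability_tight (R : realType) (Y : ptopologicalType)
    (p : probability (borel Y) R) : polish_space R Y ->
  exists F : nat -> set Y, (forall n, compact (F n)) /\
    p (~` \bigcup_n F n) = 0%E.
Proof.
move=> [sY [d [dm dtop dcompl]]].
have [u udense] := separable_dense_sequence dm dtop sY.
pose B (l J : nat) : set Y := [set y | exists2 j, (j < J)%N & closed_ball_for d
  (u j) l.+1%:R^-1 y].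
have cB l J : closed (B l J).
  rewrite (_ : B l J = \bigcup_(j in `I_J) closed_ball_for d (u j) l.+1%:R^-1).
    apply: closed_bigcup; first exact: finite_II.
    by move=> j _; exact: closed_ball_for_closed.
  by apply/seteqP; split=> y [j jJ jy]; exists j.
have mB l J : measurable (~` B l J : set (borel Y)).
  by apply: measurableC; exact: closed_measurable_borel.
have Bsmall l (e : R) : 0 < e -> exists J, (p (~` B l J) < e%:E)%E.
  move=> e0.
  have cvg : p \o (fun J => ~` B l J) @ \oo --> p (\bigcap_J ~` B l J).
    apply: nonincreasing_cvg_mu => //.
    - exact: (le_lt_trans (probability_le1 _ _) (ltry _)).
    - exact: bigcap_measurable.
    - move=> i j ij; apply/subsetPset/subsetC => y [k ki ky]; exists k => //.
      exact: leq_trans ij.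
  have B0 : \bigcap_J ~` B l J = set0.
    rewrite -subset0 => y By.
    have [k uk] := udense y (l.+1%:R^-1) (ltac:(by rewrite invr_gt0)).
    apply: (By k.+1 I); exists k => //; exact: ltW.
  rewrite B0 measure0 in cvg.
  have := cvg [set x | (x < e%:E)%E].
  have : nbhs (0 : \bar R)%E [set x | (x < e%:E)%E].
    by apply: open_nbhs_nbhs; split;
      [exact: open_ereal_lt_ereal|rewrite /= lte_fin].
  by move=> n0 /(_ n0)[J _ /(_ J (leqnn _)) ?]; exists J.
have J_ (n l : nat) : exists J, (p (~` B l J) < (n.+1%:R^-1 / (2 ^
  l.+1)%:R)%:E)%E.
  by apply: Bsmall; rewrite divr_gt0 ?invr_gt0 ?ltr0n ?expn_gt0.
pose J n l := sval (cid (J_ n l)).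
have HJ n l := svalP (cid (J_ n l)) : (p (~` B l (J n l)) < _)%E.
pose F n := \bigcap_l B l (J n l).
have cF n : closed (F n) by apply: closed_bigI.
exists F; split.
  move=> n; apply: (totally_bounded_compact dm dtop dcompl) => // e e0.
  have [l _ /(_ l (leqnn _)) /= le] := near_infty_natSinv_lt (PosNum e0).
  exists (map u (iota 0 (J n l))) => y /(_ l I)[j jJ jy].
  exists (u j); last exact: (le_trans jy (ltW le)).
  by apply: map_f; rewrite mem_iota.
have pF n : (p (~` F n) <= (n.+1%:R^-1)%:E)%E.
  apply: (@le_trans _ _ (\sum_(l <oo) p (~` B l (J n l)))%E).
    apply: measure_sigma_subadditive => //.
      by apply: measurableC; exact: closed_measurable_borel.
    by rewrite setC_bigcap.
  apply: (@le_trans _ _ (\sum_(l <oo) (n.+1%:R^-1 / (2 ^ l.+1)%:R)%:E)%E).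
    by apply: lee_nneseries => // l _; exact/ltW/HJ.
  by apply: epsilon_trick0; rewrite invr_ge0.
have mW : measurable (~` \bigcup_n F n : set (borel Y)).
  apply: measurableC; apply: bigcup_measurable => n _;
    exact: closed_measurable_borel.
apply/eqP; rewrite eq_le measure_ge0 andbT.
apply/lee_addgt0Pr => e e0; rewrite add0e.
have [n _ /(_ n (leqnn _)) /= le] := near_infty_natSinv_lt (PosNum e0).
apply: (@le_trans _ _ (n.+1%:R^-1)%:E); last by rewrite lee_fin ltW.
apply: le_trans (pF n); apply: le_measure; rewrite ?inE //.
  by apply: measurableC; exact: closed_measurable_borel.
by apply: subsetC; exact: bigcup_sup.
Qed.

(** * Measures *)

Section measure_constructions.
Context {R : realType}.

Lemma measure_weighted_sum (d : measure_display) (T : measurableType d) (n :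
  nat)
    (m : 'I_n.+1 -> {measure set T -> \bar R}) (w : 'I_n.+1 -> R) :
  (forall i, 0 <= w i) ->
  exists m' : {measure set T -> \bar R},
    (forall A, m' A = \sum_(i < n.+1) (w i)%:E * m i A)%E /\
    (forall f : T -> \bar R, (forall x, 0 <= f x)%E -> measurable_fun setT f ->
      \int[m']_x f x = \sum_(i < n.+1) (w i)%:E * \int[m i]_x f x)%E.
Proof.
move=> w0.
pose s (k : nat) : {measure set T -> \bar R} :=
  mscale (NngNum (w0 (inord k))) (m (inord k)).
exists (msum s n.+1); split.
  move=> A; rewrite /= /msum; apply: eq_bigr => i _.
  by rewrite /s /= /mscale /= inord_val.
move=> f f0 mf; rewrite ge0_integral_measure_sum//; apply: eq_bigr => i _.
by rewrite /s ge0_integral_mscale//= inord_val.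
Qed.

Section finite_measure_intro.
Context (d : measure_display) (T : measurableType d).
Variable m : {measure set T -> \bar R}.

(* Alias of [m] carrying the finite measure structure. *)
Definition measure_copy of (m setT < +oo)%E : set T -> \bar R := m.

Hypothesis moo : (m setT < +oo)%E.

HB.instance Definition _ := Measure.on (measure_copy moo).

Let measure_copy_fin : fin_num_fun (measure_copy moo).
Proof. exact: lty_fin_num_fun. Qed.

HB.instance Definition _ :=
  Measure_isFinite.Build _ _ _ (measure_copy moo) measure_copy_fin.

Lemma finite_measure_intro :
  exists m' : {finite_measure set T -> \bar R}, forall A, m' A = m A.
Proof. by exists (measure_copy moo). Qed.

End finite_measure_intro.

Section probability_intro.
Context (d : measure_display) (T : measurableType d).
Variable m : {measure set T -> \bar R}.

Definition measure_copy1 of m setT = 1%E : set T -> \bar R := m.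

Hypothesis m1 : m setT = 1%E.

HB.instance Definition _ := Measure.on (measure_copy1 m1).
HB.instance Definition _ :=
  Measure_isProbability.Build _ _ _ (measure_copy1 m1) m1.

Lemma probability_intro : exists m' : probability T R, forall A, m' A = m A.
Proof. by exists (measure_copy1 m1). Qed.

End probability_intro.

Lemma measure_pushforward (d d' : measure_display) (S : measurableType d)
    (T : measurableType d') (m : {measure set S -> \bar R}) (f : S -> T) :
  measurable_fun setT f ->
  exists m' : {measure set T -> \bar R}, forall A, m' A = m (f @^-1` A).
Proof.
move=> mf.
by exists (measure_function_pushforward__canonical__measure_function_Measure m
  mf).
Qed.

Lemma integral_concentrated (d : measure_display) (T : measurableType d)
    (m : {measure set T -> \bar R}) (D : set T) (f : T -> \bar R) :
  measurable D -> m (~` D) = 0%E -> (forall x, 0 <= f x)%E ->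
  measurable_fun setT f -> (\int[m]_x f x = \int[m]_(x in D) f x)%E.
Proof.
move=> mD mD0 f0 mf; rewrite -(setUv D) ge0_integral_setU//.
- rewrite [X in (_ + X)%E](_ : _ = 0%E) ?adde0//.
  apply: null_set_integral => //; first exact: measurableC.
  exact: measurable_funTS.
- exact: measurableC.
- by rewrite setUv.
- exact/disj_setPCl.
Qed.

Lemma ge_integral_concentrated (d : measure_display) (T : measurableType d)
    (m : {measure set T -> \bar R}) (D : set T) (f : T -> R) (l : R) :
  measurable D -> m (~` D) = 0%E -> (forall x, 0 <= f x) ->
  measurable_fun setT f -> (forall x, D x -> l <= f x) ->
  (l%:E * m D <= \int[m]_x (f x)%:E)%E.
Proof.
move=> mD mD0 f0 mf lf.
(* A negative [l] is harmless because [f] is nonnegative. *)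
have [l0|l0] := ltP l 0.
  apply: (@le_trans _ _ 0%E); last by apply: integral_ge0 => x _;
    rewrite lee_fin.
  by rewrite mule_le0_ge0// lee_fin ltW.
rewrite (integral_concentrated mD)//; last exact/measurable_EFinP.
rewrite -integral_cst//; apply: ge0_le_integral => //.
exact/measurable_funTS/measurable_EFinP.
Qed.

Lemma le_integral_concentrated (d : measure_display) (T : measurableType d)
    (m : {measure set T -> \bar R}) (D : set T) (f : T -> R) (u : R) :
  measurable D -> m (~` D) = 0%E -> (forall x, 0 <= f x) -> 0 <= u ->
  measurable_fun setT f -> (forall x, D x -> f x <= u) ->
  (\int[m]_x (f x)%:E <= u%:E * m D)%E.
Proof.
move=> mD mD0 f0 u0 mf lf.
rewrite (integral_concentrated mD)//; last exact/measurable_EFinP.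
rewrite -integral_cst//; apply: ge0_le_integral => //.
  by move=> x _; rewrite lee_fin.
exact/measurable_funTS/measurable_EFinP.
Qed.

(** The product of the first marginal of [m] on [D] and the second marginal of [m] on [D'], carried
    from the product sigma-algebra to the Borel one by the identity, which is measurable thanks to
    the network. *)
Lemma measure_marginals_product (X Y : ptopologicalType) (V : nat -> set Y)
    (m : {finite_measure set (borel (X * Y)%type) -> \bar R})
    (D D' : set (borel (X * Y)%type)) :
  network V -> (forall k, closed (V k)) -> measurable D -> measurable D' ->
  exists p : {measure set (borel (X * Y)%type) -> \bar R},
    forall (A : set (borel X)) (B : set (borel Y)), measurable A -> measurable
      B ->
      p (A `*` B) = (m ([set z | A z.1] `&` D) * m ([set z | B z.2] `&` D'))%E.
Proof.
move=> nV cV mD mD'.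
have [m1 Em1] := measure_pushforward (mrestr m mD) (@measurable_fst_borel X Y).
have [m2' Em2'] := measure_pushforward (mrestr m mD') (@measurable_snd_borel X
  Y).
have [|m2 Em2] := @finite_measure_intro _ _ m2'.
  by rewrite Em2' preimage_setT -ge0_fin_numE ?measure_ge0// fin_num_measure.
have mid : measurable_fun setT ((fun z => (z.1, z.2)) :
    (borel X * borel Y)%type -> borel (X * Y)%type).
  by apply: (measurable_fun_pair_borel nV cV);
    [exact: measurable_fst|exact: measurable_snd].
have [p Ep] := measure_pushforward (m1 \x m2)%E mid.
exists p => A B mA mB; rewrite Ep.
rewrite (_ : _ @^-1` _ = (A `*` B : set (borel X * borel Y)%type)).
  rewrite [LHS](product_measure1E m1 m2 mA mB).
  by congr (_ * _)%E; [exact: Em1|exact: etrans (Em2 _) (Em2' _)].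
by apply/seteqP; split.
Qed.

End measure_constructions.

(** * Cyclical monotonicity *)

(** An injective self-map of a finite ordinal is a permutation, so all rearrangements of second
    coordinates are covered, not only cycles. *)
Definition cyclically_monotone (R : realType) (X Y : Type) (c : X * Y -> R)
    (G : set (X * Y)) :=
  forall (n : nat) (s : 'I_n.+1 -> 'I_n.+1) (z : 'I_n.+1 -> X * Y),
    injective s -> (forall i, G (z i)) ->
    \sum_i c (z i) <= \sum_i c ((z i).1, (z (s i)).2).

Section optimal_plans.
Context {R : realType} {X Y : ptopologicalType}.
Variables (V : nat -> set Y) (nV : network V) (cV : forall k, closed (V k)).
Variables (mu : probability (borel X) R) (nu : probability (borel Y) R).
Variables (c : X * Y -> R) (hc : continuous c) (B : R).
Hypothesis cB : forall z, `|c z| <= B.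

Let mc : measurable_fun [set: borel (X * Y)%type] (c : borel (X * Y)%type -> R).
Proof. exact: (@continuous_measurable_borelR R (X * Y)%type). Qed.

(** Replacing [c] by the nonnegative [c + B] shifts all costs equally, and allows integrals to be
    split over sums of measures. *)
Lemma integral_cost_shift (p : probability (borel (X * Y)%type) R) :
  (\int[p]_z (c z + B)%:E = transport_cost c p + B%:E)%E.
Proof.
under eq_integral do rewrite EFinD.
rewrite integralD//=.
- congr (_ + _)%E; rewrite (integral_cst p measurableT B%:E).
  by rewrite [X in (_ * X)%E](probability_setT p) mule1.
- apply: measurable_bounded_integrable => //.
    by rewrite [X in (X < _)%E](probability_setT p) ltry.
  by exists B; split; [exact: num_real|move=> M BM z _ /=;
    exact: le_trans (cB z) (ltW BM)].
- exact: finite_measure_integrable_cst.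
Qed.

Variable gamma : probability (borel (X * Y)%type) R.
Hypothesis hgamma : optimal_plan c mu nu gamma.

(** Optimality is tested against a coupling that removes the same mass [k] from every rectangle and
    pairs first coordinates of rectangle [i] with second coordinates of rectangle [s i]. Up to the
    shift by [B], the removed mass costs at least [k] times the sum of the [l i], the inserted mass
    at most [k] times the sum of the [u i]. *)
Lemma optimal_exchange (n : nat) (s : 'I_n.+1 -> 'I_n.+1)
    (E : 'I_n.+1 -> set (borel X)) (F : 'I_n.+1 -> set (borel Y))
    (l u : 'I_n.+1 -> R) :
  injective s -> (forall i, measurable (E i)) -> (forall i, measurable (F i)) ->
  (forall i, gamma (E i `*` F i) != 0%E) ->
  (forall i x y, E i x -> F i y -> l i <= c (x, y)) ->
  (forall i x y, E i x -> F (s i) y -> c (x, y) <= u i) ->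
  \sum_i l i <= \sum_i u i.
Proof.
move=> s_inj mE mF g0 lc cu.
pose D i : set (borel (X * Y)%type) := E i `*` F i.
have mD i : measurable (D i) by exact: measurable_setX_borel.
have mDC i : measurable (~` D i) by exact: measurableC.
pose g A := fine (gamma A).
have gE A : measurable A -> gamma A = (g A)%:E.
  by move=> mA; rewrite /g fineK// fin_num_measure.
pose p i := g (D i).
have p0 i : 0 < p i.
  by rewrite -lte_fin -gE// lt0e g0 measure_ge0.
have pn0 i : p i != 0 by rewrite gt_eqF.
(* This [k] makes the weights [q i = k / p i] sum to 1, and [q i * p i = k] is the mass exchanged on
   each rectangle. A convex combination stays a positive measure even if the rectangles overlap. *)
pose k := (\sum_i (p i)^-1)^-1.
have k0 : 0 < k.
  rewrite invr_gt0 (bigD1 ord0)//= ltr_wpDr ?invr_gt0// sumr_ge0// => i _.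
  by rewrite invr_ge0 ltW.
pose q i := k / p i.
have q0 i : 0 <= q i by rewrite divr_ge0// ltW.
have q1 : \sum_i q i = 1.
  by rewrite -mulr_sumr mulVf// gt_eqF// -invr_gt0.
have gD A i : measurable A -> g A = g (A `&` ~` D i) + g (A `&` D i).
  move=> mA; apply: EFin_inj; rewrite EFinD -!gE//.
  - by rewrite -setDE; exact: measureDI.
  - exact: measurableI.
  - exact: measurableI.
have [pi Epi] := choice (fun i => measure_marginals_product gamma nV cV (mD i)
  (mD (s i))).
have {}Epi i (A : set (borel X)) (A' : set (borel Y)) :
    measurable A -> measurable A' ->
    pi i (A `*` A') = (g ([set z | A z.1] `&` D i) * g ([set z | A' z.2] `&` D
      (s i)))%:E.
  move=> mA mA'; rewrite Epi// EFinM; congr (_ * _)%E; apply: gE.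
    by apply: measurableI => //; exact: measurable_fst_preimage.
  by apply: measurableI => //; exact: measurable_snd_preimage.
have ps0 i : 0 <= (p (s i))^-1 by rewrite invr_ge0 ltW.
pose T i : {measure set (borel (X * Y)%type) -> \bar R} :=
  measure_add (mrestr gamma (mDC i)) (mscale (NngNum (ps0 i)) (pi i)).
have TE i A : T i A = (gamma (A `&` ~` D i) + (p (s i))^-1%:E * pi i A)%E.
  exact: (measure_addE (mrestr gamma (mDC i)) (mscale (NngNum (ps0 i)) (pi i))).
(* competitor: with probability [q i], replace [gamma] on [D i] by the product
   of its marginals on [D i] and [D (s i)], rescaled to the same mass *)
have [m' [Em' Im']] := measure_weighted_sum T q0.
have fstE (A : set X) : [set z : X * Y | A z.1] = A `*` setT.
  by apply/seteqP; split => z //= [].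
have sndE (A : set Y) : [set z : X * Y | A z.2] = setT `*` A.
  by apply/seteqP; split => z //= [].
have mfst (A : set (borel X)) : measurable A -> m' [set z | A z.1] = gamma [set
  z | A z.1].
  move=> mA; have mA1 := @measurable_fst_preimage X Y A mA.
  rewrite Em' (gE _ mA1) -[g _]mul1r -q1 mulr_suml -sumEFin.
  apply: eq_bigr => i _; rewrite [RHS]EFinM; congr (_ * _)%E.
  rewrite TE {2}fstE Epi//.
  rewrite (_ : [set z | setT z.2] `&` D (s i) = D (s i)); last first.
    by apply/seteqP; split => z // [].
  rewrite gE; last exact: measurableI.
  by rewrite -!EFinM -EFinD -/(p _) mulrCA mulVf// mulr1 -gD.
have msnd (A : set (borel Y)) : measurable A -> m' [set z | A z.2] = gamma [set
  z | A z.2].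
  move=> mA; have mA2 := @measurable_snd_preimage X Y A mA.
  rewrite Em' (gE _ mA2) -[g _]mul1r -q1 mulr_suml.
  under eq_bigr => i _.
    rewrite TE {2}sndE Epi//.
    rewrite (_ : [set z | setT z.1] `&` D i = D i); last first.
      by apply/seteqP; split => z // [].
    rewrite gE; last exact: measurableI.
    rewrite -!EFinM -/(p _).
    rewrite (_ : q i * _ = q i * g ([set z | A z.2] `&` ~` D i) +
       k * (g ([set z | A z.2] `&` D (s i)) / p (s i))); last first.
      by rewrite /q; field; rewrite !pn0.
    over.
  rewrite sumEFin big_split/=.
  (* Unlike the first marginal, the second is not preserved for each [i] separately; it balances
     after reindexing the sum by [s]. *)
  have <- : \sum_i k * (g ([set z | A z.2] `&` D i) / p i) =
      \sum_i k * (g ([set z | A z.2] `&` D (s i)) / p (s i)).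
    by rewrite (reindex_inj s_inj).
  rewrite -big_split; congr (_%:E); apply: eq_bigr => i _ /=.
  by rewrite (gD _ i mA2) mulrDr; congr (_ + _); rewrite /q mulrAC mulrA.
have mT : m' setT = 1%E.
  exact: etrans (mfst _ measurableT) (probability_setT gamma).
have [pr Epr] := probability_intro mT.
have cpr : couplings mu nu pr.
  have [[g1 g2] _] := hgamma; split=> A mA; rewrite Epr.
    by rewrite mfst// g1.
  by rewrite msnd// g2.
have opt : (transport_cost c gamma <= transport_cost c pr)%E.
  have [_ ->] := hgamma; apply: ereal_inf_lbound; by exists pr.
pose f z := c z + B.
have f0 z : 0 <= f z by have := cB z; rewrite ler_norml /f; lra.
have mf : measurable_fun [set: borel (X * Y)%type] (f : borel (X * Y)%type ->
  R).
  exact: measurable_funD.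
have mfE : measurable_fun [set: borel (X * Y)%type] (EFin \o f : borel (X *
  Y)%type -> \bar R).
  exact/measurable_EFinP.
have f0E z : (0 <= (EFin \o f) z)%E by rewrite lee_fin.
have int_pr : (\int[pr]_z (f z)%:E = \int[m']_z (f z)%:E)%E.
  by apply: eq_measure_integral => A _ _; exact: Epr.
have opt' : (\int[gamma]_z (f z)%:E <= \int[m']_z (f z)%:E)%E.
  by rewrite -int_pr !integral_cost_shift leeD2r.
have Jfin : (\int[gamma]_z (f z)%:E \is a fin_num)%E.
  rewrite ge0_fin_numE; last by apply: integral_ge0 => z _; exact: f0E.
  apply: (@le_lt_trans _ _ ((B + B)%:E * gamma setT)%E).
    apply: le_integral_concentrated => //.
    - by rewrite setCT.
    - by have := cB (point, point); have := normr_ge0 (c (point, point)); lra.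
    - by move=> z _; have := cB z; rewrite ler_norml /f; lra.
  by rewrite [X in (_ * X)%E](probability_setT gamma) mule1 ltry.
pose I i := (\int[mrestr gamma (mDC i)]_z (f z)%:E)%E.
pose L i := (\int[mrestr gamma (mD i)]_z (f z)%:E)%E.
pose U i := (\int[pi i]_z (f z)%:E)%E.
have I0 i : (0 <= I i)%E by apply: integral_ge0 => z _; exact: f0E.
have L0 i : (0 <= L i)%E by apply: integral_ge0 => z _; exact: f0E.
have U0 i : (0 <= U i)%E by apply: integral_ge0 => z _; exact: f0E.
have JIL i : (\int[gamma]_z (f z)%:E = I i + L i)%E.
  transitivity (\int[measure_add (mrestr gamma (mDC i)) (mrestr gamma (mD
    i))]_z (f z)%:E)%E.
    apply: eq_measure_integral => A mA _.
    rewrite [RHS](measure_addE (mrestr gamma (mDC i)) (mrestr gamma (mD i))).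
    exact: (measureDI gamma mA (mD i)).
  exact: (ge0_integral_measure_add (mrestr gamma (mDC i)) (mrestr gamma (mD i))
    measurableT (fun z _ => f0E z) mfE).
have Ifin i : I i \is a fin_num.
  rewrite ge0_fin_numE//;
    apply: le_lt_trans (_ : \int[gamma]_z (f z)%:E < +oo)%E.
    by rewrite (JIL i) leeDl.
  by rewrite -ge0_fin_numE//; apply: integral_ge0 => z _; exact: f0E.
have Lfin i : L i \is a fin_num.
  rewrite ge0_fin_numE//;
    apply: le_lt_trans (_ : \int[gamma]_z (f z)%:E < +oo)%E.
    by rewrite (JIL i) leeDr.
  by rewrite -ge0_fin_numE//; apply: integral_ge0 => z _; exact: f0E.
have Lge i : (((l i + B) * p i)%:E <= L i)%E.
  have -> : (((l i + B) * p i)%:E = (l i + B)%:E * mrestr gamma (mD i) (D i))%E.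
    by rewrite /mrestr setIid gE.
  apply: ge_integral_concentrated => //.
    by rewrite [LHS](_ : _ = gamma (~` D i `&` D i))// setICl measure0.
  by move=> [x y] [/= Ex Fy]; rewrite /f lerD2r; exact: lc.
have ne i : D i !=set0.
  apply/set0P/negP => /eqP D0; move: (g0 i); rewrite -/(D i) D0 measure0.
  by rewrite eqxx.
have Ule i : (U i <= ((u i + B) * (p i * p (s i)))%:E)%E.
  have piE : pi i (E i `*` F (s i)) = (p i * p (s i))%:E.
    rewrite Epi//; congr ((g _ * g _)%:E).
      by apply/seteqP; split => [z []|z [? ?]].
    by apply/seteqP; split => [z []|z [? ?]].
  have -> : (((u i + B) * (p i * p (s i)))%:E = (u i + B)%:E * pi i (E i `*` F
    (s i)))%E.
    by rewrite piE.
  apply: le_integral_concentrated => //.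
  - exact: measurable_setX_borel.
  - rewrite (_ : ~` _ = (~` E i `*` setT) `|` (setT `*` ~` F (s i))).
      have h1 : pi i (~` E i `*` setT) = 0%E.
        rewrite Epi//; last exact: measurableC.
        rewrite (_ : _ `&` D i = set0); first by rewrite /g measure0 mul0r.
        by apply/seteqP; split => z //= [nE [/nE]].
      have h2 : pi i (setT `*` ~` F (s i)) = 0%E.
        rewrite Epi//; last exact: measurableC.
        rewrite [X in _ * g X](_ : _ = set0);
          first by rewrite /g measure0 mulr0.
        by apply/seteqP; split => z //= [nE [_ /nE]].
      rewrite measureU0//; first by
        apply: measurable_setX_borel => //; exact: measurableC.
      by apply: measurable_setX_borel => //; exact: measurableC.
    apply/seteqP; split=> [[x y] /= nEF|[x y] /= [[nE _] [Ex _]|[_ nF] [_ Fy]]].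
    + have [Ex|nEx] := pselect (E i x); last by left.
      by right; split => // Fy; exact: nEF.
    + exact: nE.
    + exact: nF.
  (* A point of [E i * F (s i)] shows that the bound [u i + B] is nonnegative. *)
  - have [[x y] [/= Ex _]] := ne i; have [[x' y'] [/= _ Fy']] := ne (s i).
    by have := cu i x y' Ex Fy'; have := f0 (x, y'); rewrite /f; lra.
  - by move=> [x y] [/= Ex Fy]; rewrite /f lerD2r; exact: cu.
have Ufin i : U i \is a fin_num.
  by rewrite ge0_fin_numE//; apply: le_lt_trans (Ule i) (ltry _).
move: opt'; rewrite Im'//.
have -> : (\int[gamma]_z (f z)%:E = \sum_i (q i)%:E * (I i + L i))%E.
  under eq_bigr => i _ do rewrite -JIL -(fineK Jfin) -EFinM.
  by rewrite sumEFin -mulr_suml q1 mul1r fineK.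
have TI i : (\int[T i]_z (f z)%:E = I i + (p (s i))^-1%:E * U i)%E.
  rewrite [LHS](ge0_integral_measure_add (mrestr gamma (mDC i))
    (mscale (NngNum (ps0 i)) (pi i)) measurableT (fun z _ => f0E z) mfE).
  congr (_ + _)%E; exact: (ge0_integral_mscale (pi i) measurableT (NngNum (ps0
    i)) mfE (fun z _ => f0E z)).
under [leRHS]eq_bigr => i _ do
  rewrite TI -(fineK (Ifin i)) -(fineK (Ufin i)) -EFinM.
under [leLHS]eq_bigr => i _ do
  rewrite -(fineK (Ifin i)) -(fineK (Lfin i)) -EFinM.
rewrite !sumEFin lee_fin => le1.
(* The finite costs [I i] outside the rectangles cancel. *)
have {}le1 : \sum_i q i * fine (L i) <= \sum_i q i * ((p (s i))^-1 * fine (U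
  i)).
  move: le1; under eq_bigr do rewrite mulrDr.
  under [leRHS]eq_bigr do rewrite mulrDr.
  by rewrite !big_split/= lerD2l.
have le2 : k * \sum_i (l i + B) <= \sum_i q i * fine (L i).
  rewrite mulr_sumr; apply: ler_sum => i _.
  rewrite /q -mulrA ler_pM2l// ler_pdivlMl// mulrC -lee_fin fineK//.
have le3 : \sum_i q i * ((p (s i))^-1 * fine (U i)) <= k * \sum_i (u i + B).
  rewrite mulr_sumr; apply: ler_sum => i _.
  rewrite /q -mulrA ler_pM2l// ler_pdivrMl// ler_pdivrMl//.
  rewrite -lee_fin fineK//; apply: le_trans (Ule i) _.
  by rewrite lee_fin le_eqVlt; apply/orP; left; apply/eqP; ring.
have := le_trans le2 (le_trans le1 le3).
by rewrite ler_pM2l// !big_split/= lerD2r.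
Qed.

(** An entry of [t] is a network index with a lower and an upper rational bound. There are countably
    many lists [t], so these slabs stand in for a base of [X]. *)
Lemma closed_cost_slab (t : seq (nat * rat * rat)) :
  closed [set x | forall a, a \in t -> forall y, V a.1.1 y ->
    ratr a.1.2 <= c (x, y) <= ratr a.2].
Proof.
rewrite (_ : [set x | _] = \bigcap_(a in [set` t]) \bigcap_(y in V a.1.1)
    (fun x => c (x, y)) @^-1` [set` `[ratr a.1.2, ratr a.2]]).
  apply: closed_bigI => a _; apply: closed_bigI => y _.
  apply: closed_comp; last exact: interval_closed.
  move=> x _; apply: continuous_comp; last exact: hc.
  by apply: cvg_pair; [exact: cvg_id|exact: cvg_cst].
by apply/seteqP; split=> x xt a aH y /(xt a aH y) /=; rewrite in_itv.
Qed.

(** Removing the countably many null rectangles [E t * V k] leaves a set of full measure, and every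
    such rectangle around one of its points has positive mass. Finitely many of its points are
    enclosed in rectangles on which the costs vary by at most [h], and [optimal_exchange] gives the
    inequality up to [e]. *)
Lemma optimal_concentrated : exists G : set (borel (X * Y)%type),
  [/\ measurable G, gamma (~` G) = 0%E & cyclically_monotone c G].
Proof.
pose E (t : seq (nat * rat * rat)) : set (borel X) := [set x | forall a, a \in
  t -> forall y, V a.1.1 y ->
    ratr a.1.2 <= c (x, y) <= ratr a.2].
have mE t : measurable (E t) by apply: closed_measurable_borel;
  exact: closed_cost_slab.
have mV k : measurable (V k : set (borel Y)) by exact: closed_measurable_borel.
pose N (i : nat) : set (borel (X * Y)%type) :=
  if @unpickle (seq (nat * rat * rat) * nat)%type i is Some tk then
    if gamma (E tk.1 `*` V tk.2) == 0%E then E tk.1 `*` V tk.2 else set0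
  else set0.
have mN i : measurable (N i).
  rewrite /N; case: unpickle => [tk|//]; case: ifP => // _.
  exact: measurable_setX_borel.
have N0 i : gamma (N i) = 0%E.
  rewrite /N; case: unpickle => [tk|]; last by rewrite measure0.
  by case: ifPn => [/eqP//|_]; rewrite measure0.
have mU : measurable (\bigcup_i N i) by exact: bigcup_measurable.
exists (~` \bigcup_i N i); split.
- exact: measurableC.
- rewrite setCK; apply/negligibleP => //; apply: negligible_bigcup => i.
  by apply/(negligibleP _ (mN i)); exact: N0.
move=> n s z s_inj Gz; apply/ler_addgt0Pr => e e0.
(* An error [h] is lost on each of the [n.+1] terms of both sums, in total [e]. *)
pose h := e / (n.+1%:R *+ 2).
have h0 : 0 < h by rewrite divr_gt0// pmulrn_lgt0.
have /choice[k Hk] : forall j : 'I_n.+1, exists k, V k (z j).2 /\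
    forall y i, V k y -> `|c ((z i).1, y) - c ((z i).1, (z j).2)| < h / 2.
  move=> j.
  have nb : \forall y \near (z j).2, forall i, `|c ((z i).1, y) - c ((z i).1,
    (z j).2)| < h / 2.
    apply: filter_forall => i.
    have cc : {for (z j).2, continuous (fun y => c ((z i).1, y))}.
      by apply: continuous_comp; [apply: cvg_pair;
        [exact: cvg_cst|exact: cvg_id]|exact: hc].
    have h20 : 0 < h / 2 by rewrite divr_gt0.
    by have /cvgr_distC_lt /(_ _ h20) := cc; apply: filterS => y.
  have [k [Vk kU]] := nV (open_interior _) nb.
  exists k; split => // y i /kU/interior_subset; exact.
(* The rational bounds leave room for the oscillation [h / 2] of [c] in [y], yet stay within [h] of
   the true value. *)
have rat_below (r : R) : exists q : rat, r - h <= ratr q <= r - h / 2.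
  have [|q] := @rat_in_itvoo R (r - h) (r - h / 2); first by lra.
  by rewrite in_itv/= => /andP[? ?]; exists q; rewrite !ltW.
have rat_above (r : R) : exists q : rat, r + h / 2 <= ratr q <= r + h.
  have [|q] := @rat_in_itvoo R (r + h / 2) (r + h); first by lra.
  by rewrite in_itv/= => /andP[? ?]; exists q; rewrite !ltW.
have [lo Hlo] := choice rat_below; have [up Hup] := choice rat_above.
pose t i := [seq (k j, lo (c ((z i).1, (z j).2)), up (c ((z i).1, (z j).2))) |
  j <- enum 'I_n.+1].
have Ez i : E (t i) (z i).1.
  move=> _ /mapP[j _ ->] y /= Vy.
  have /andP[_ l1] := Hlo (c ((z i).1, (z j).2)).
  have /andP[u1 _] := Hup (c ((z i).1, (z j).2)).
  have [_ /(_ y i Vy)] := Hk j.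
  by rewrite ltr_norml => /andP[? ?]; apply/andP; split; lra.
have Ec i j x y : E (t i) x -> V (k j) y ->
    c ((z i).1, (z j).2) - h <= c (x, y) <= c ((z i).1, (z j).2) + h.
  move=> /(_ (k j, lo (c ((z i).1, (z j).2)), up (c ((z i).1, (z j).2)))) Ex Vy.
  have /andP[? ?] : ratr (lo (c ((z i).1, (z j).2))) <= c (x, y) <= ratr (up (c
    ((z i).1, (z j).2))).
    by apply: Ex => //=; apply: map_f; rewrite mem_enum.
  have /andP[l1 _] := Hlo (c ((z i).1, (z j).2)).
  have /andP[_ u1] := Hup (c ((z i).1, (z j).2)).
  by apply/andP; split; lra.
have := @optimal_exchange n s (fun i => E (t i)) (fun j => V (k j))
  (fun i => c (z i) - h) (fun i => c ((z i).1, (z (s i)).2) + h) s_inj.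
move=> /(_ (fun i => mE _) (fun j => mV _)) exch.
have : \sum_i (c (z i) - h) <= \sum_i (c ((z i).1, (z (s i)).2) + h).
  apply: exch.
  - move=> i; apply/negP => g0; apply: (Gz i).
    exists (pickle (t i, k i)) => //; rewrite /N pickleK /= g0.
    by split; [exact: Ez|have [] := Hk i].
  - by move=> i x y Ex Vy; have /andP[+ _] := Ec i i x y Ex Vy; case: (z i).
  - by move=> i x y Ex Vy; have /andP[] := Ec i (s i) x y Ex Vy.
rewrite !big_split/= sumrN !sumr_const card_ord.
have -> : e = h *+ n.+1 *+ 2.
  by rewrite /h -!mulrnA -[RHS]mulr_natr mulfVK// pnatr_eq0.
move: (h *+ n.+1) => w; lra.
Qed.

End optimal_plans.

(** * c-concave potentials *)

Section potential.
Context {R : realType} {X Y : ptopologicalType}.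
Variables (c : X * Y -> R) (B : R).
Hypothesis cB : forall z, `|c z| <= B.

(** Rockafellar's chain sum: with [z i = (x_i, y_i)], it equals [c (x, y_n) - c (x_n, y_n) + ... + c
    (x_1, y_0) - c (x_0, y_0)]. *)
Let chain_cost (x : X) (n : nat) (z : nat -> X * Y) :=
  c (x, (z n).2) + (\sum_(i < n) c ((z i.+1).1, (z i).2) - \sum_(i < n.+1) c (z
    i)).

(** [phi] is the infimum of the chain sums over chains in [G] from a fixed [z0]. [L] records the
    last second coordinate and the constant of each chain, so that [phi] is an infimum of functions
    [c (., l.1) + l.2]. Appending [(x, y)] to a chain gives the last inequality. *)
Lemma cyclically_monotone_potential (G : set (X * Y)) :
  cyclically_monotone c G -> G !=set0 ->
  exists (phi : X -> R) (L : set (Y * R)),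
    [/\ forall x l, L l -> phi x <= c (x, l.1) + l.2,
        forall x (e : R), 0 < e -> exists2 l, L l & c (x, l.1) + l.2 < phi x +
          e &
        forall x y x', G (x, y) -> phi x' <= phi x + c (x', y) - c (x, y)].
Proof.
move=> cmG [z0 Gz0].
pose P := [set nz : nat * (nat -> X * Y) | nz.2 0%N = z0 /\ forall i, G (nz.2
  i)].
have chain0 nz : P nz -> 0 <= chain_cost z0.1 nz.1 nz.2.
  case: nz => n z [/= z00 Gz].
  (* The cyclic shift pairs [x_i] with [y_(i-1)] and [x_0] with [y_n], which closes the chain at its
     start. *)
  have := cmG n (@ord_pred n.+1) (fun i => z i) (@ord_pred_inj _) (fun i => Gz
    i).
  have e0 : nat_of_ord (ord_pred (@ord0 n)) = n by rewrite /= modn_small.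
  have e1 (j : 'I_n) : nat_of_ord (ord_pred (lift (@ord0 n) j)) = j.
    by rewrite [LHS](_ : _ = (j + n.+1) %% n.+1)%N// modnDr modn_small// ltnS
      ltnW.
  rewrite [leRHS]big_ord_recl e0; under [X in _ <= _ + X]eq_bigr do rewrite e1.
  by rewrite /chain_cost z00 /=; lra.
pose S x := [set chain_cost x nz.1 nz.2 | nz in P].
have P0 : P (0%N, fun=> z0) by [].
have S0 x : S x !=set0 by exists (chain_cost x 0%N (fun=> z0));
  exists (0%N, fun=> z0).
(* Passing from [z0.1] to [x] changes a single term of the sum, by at most [B + B]. *)
have Slb x : lbound (S x) (- (B + B)).
  move=> _ [[n z] Pz <-] /=.
  have := chain0 _ Pz; rewrite /chain_cost /=.
  have := cB (x, (z n).2); have := cB (z0.1, (z n).2).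
  by rewrite !ler_norml; lra.
have Sinf x : has_inf (S x) by split; [exact: S0|exists (- (B + B))].
pose phi x := inf (S x).
pose L := [set ((nz.2 nz.1).2, \sum_(i < nz.1) c ((nz.2 i.+1).1, (nz.2 i).2) -
   \sum_(i < nz.1.+1) c (nz.2 i)) | nz in P].
have phi_le x nz : P nz -> phi x <= chain_cost x nz.1 nz.2.
  by move=> Pnz; apply: ge_inf; [exact: (Sinf x).2|exists nz].
exists phi, L; split.
- by move=> x _ [nz Pnz <-]; exact: phi_le.
- move=> x e e0; have [_ [nz Pnz <-] lt] := inf_adherent e0 (Sinf x).
  by exists ((nz.2 nz.1).2, \sum_(i < nz.1) c ((nz.2 i.+1).1, (nz.2 i).2) -
    \sum_(i < nz.1.+1) c (nz.2 i)) => //; exists nz.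
move=> x y x' Gxy.
suff : phi x' - c (x', y) + c (x, y) <= phi x by lra.
apply: lb_le_inf => // _ [[n z] [/= z00 Gz] <-].
(* The chain is constant after [n], so all its terms lie in [G]; only the one at [n.+1] counts. *)
pose z' i := if (i <= n)%N then z i else (x, y).
have := phi_le x' (n.+1, z'); rewrite /chain_cost /= => le.
have {le} : phi x' <= c (x', (z' n.+1).2) + (\sum_(i < n.+1) c ((z' i.+1).1,
  (z' i).2) - \sum_(i < n.+2) c (z' i)).
  by apply: le; split => //= i; rewrite /z'; case: ifP.
have z'n : z' n.+1 = (x, y) by rewrite /z' ltnn.
have z'i i : (i <= n)%N -> z' i = z i by rewrite /z' => ->.
have -> : \sum_(i < n.+1) c ((z' i.+1).1, (z' i).2) =
    \sum_(i < n) c ((z i.+1).1, (z i).2) + c (x, (z n).2).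
  rewrite big_ord_recr /= z'n z'i//; congr (_ + _); apply: eq_bigr => i _.
  by rewrite !z'i// ltnW.
have -> : \sum_(i < n.+2) c (z' i) = \sum_(i < n.+1) c (z i) + c (x, y).
  rewrite big_ord_recr /= z'n; congr (_ + _); apply: eq_bigr => i _.
  by rewrite z'i// -ltnS.
rewrite z'n /=.
by rewrite /chain_cost; lra.
Qed.

Variables (phi : X -> R) (L : set (Y * R)).
Hypothesis phi_le : forall x l, L l -> phi x <= c (x, l.1) + l.2.
Hypothesis phi_inf :
  forall x (e : R), 0 < e -> exists2 l, L l & c (x, l.1) + l.2 < phi x + e.

(** The witness for [psi] is the c-transform of [phi]. One inequality is immediate; the other holds
    because [psi l.1] is at least [- l.2] for [l] in [L], and such pairs nearly attain [phi x]. *)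
Lemma potential_c_concave : c_concave c (EFin \o phi).
Proof.
split=> //; first by exists point.
exists (fun y => ereal_inf (range (fun x => (c (x, y) - phi x)%:E))) => x.
apply/eqP; rewrite eq_le; apply/andP; split.
  apply: le_ereal_inf_tmp => _ [y _ <-] /=.
  have : (ereal_inf (range (fun x => (c (x, y) - phi x)%:E)) <= (c (x, y) - phi
    x)%:E)%E.
    by apply: ereal_inf_lbound; exists x.
  case: (ereal_inf _) => [r| |] //=.
    by rewrite lee_fin -EFinB lee_fin; lra.
  by rewrite leey.
apply/lee_addgt0Pr => e e0; have [l Ll lt] := phi_inf x e0.
apply: (@le_trans _ _ ((c (x, l.1))%:E -
    ereal_inf (range (fun x => (c (x, l.1) - phi x)%:E)))%E).
  by apply: ereal_inf_lbound; exists l.1.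
have : ((- l.2)%:E <= ereal_inf (range (fun x => (c (x, l.1) - phi x)%:E)))%E.
  by apply: le_ereal_inf_tmp => _ [x' _ <-]; rewrite lee_fin;
    have := phi_le x' Ll; lra.
case: (ereal_inf _) => [r|_|//]; last by rewrite addeNy leNye.
by rewrite lee_fin => le; rewrite -EFinB -EFinD lee_fin; lra.
Qed.

Hypothesis hc : continuous c.

(** [phi] is only an infimum of continuous functions. Since [phi z.1] is on the larger side, it can
    be replaced by each of them, which leaves an intersection of closed conditions. *)
Lemma c_superdifferential_closed :
  closed [set z | forall x', phi x' <= phi z.1 + c (x', z.2) - c z].
Proof.
rewrite (_ : [set z | _] = \bigcap_x' \bigcap_(l in L)
   (fun z => c (z.1, l.1) + l.2 + c (x', z.2) - c z) @^-1` [set` `[phi x',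
     +oo[]).
  apply: closed_bigI => x' _; apply: closed_bigI => l _.
  apply: closed_comp; last exact: interval_closed.
  move=> z _; apply: cvgB; last exact: hc.
  apply: cvgD; first apply: cvgD; last 2 first.
  - exact: cvg_cst.
  - apply: (@continuous_comp _ _ _ (fun z : X * Y => (x', z.2)));
    last exact: hc.
    by apply: cvg_pair; [exact: cvg_cst|exact: cvg_snd].
  - apply: (@continuous_comp _ _ _ (fun z : X * Y => (z.1, l.1)));
    last exact: hc.
    by apply: cvg_pair; [exact: cvg_fst|exact: cvg_cst].
apply/seteqP; split=> z /= zK x'.
  by move=> _ l Ll /=; rewrite in_itv/= andbT; have := zK x';
    have := phi_le z.1 Ll; lra.
suff : phi x' - c (x', z.2) + c z <= phi z.1 by lra.
apply/ler_addgt0Pr => e /(phi_inf z.1)[l Ll lt].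
by have := zK x' I l Ll; rewrite /= in_itv/= andbT; lra.
Qed.

End potential.

(** * Differentials and the twist condition *)

Lemma derive_ge0_at_min (R : realType) (V : normedModType R) (h : V -> R)
    (a v : V) :
  differentiable h a -> (forall w, h a <= h w) -> 0 <= 'd h a v.
Proof.
move=> dh hmin; rewrite -deriveE//.
have dv : derivable h a v by exact: diff_derivable.
rewrite ['D_v h a]cvg_at_rightE//; apply: limr_ge.
  rewrite -(cvg_at_rightE (fun t : R => t^-1 *: ((h \o shift a) (t *: v) - h
    a)))//.
  apply: cvg_trans dv; apply: cvg_app.
  move=> A [e egt0 Ae]; exists e => // x xe xgt0; apply: Ae => //.
  exact/lt0r_neq0.
near=> t; apply: mulr_ge0; last by rewrite subr_ge0; exact: hmin.
by rewrite invr_ge0; apply: ltW; near: t; exists 1 => /=.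
Unshelve. all: by end_near. Qed.

(** [g - f] is minimal at [a], so its differential is nonnegative along both [v] and [- v]. *)
Lemma diff_eq_of_touching (R : realType) (V : normedModType R) (f g : V -> R)
    (a : V) :
  differentiable f a -> differentiable g a ->
  (forall w, f w - f a <= g w - g a) -> 'd f a = 'd g a :> (V -> R).
Proof.
move=> df dg fg; apply/funext => v.
have dh : differentiable (g - f) a by exact: differentiableB.
have hmin w : (g - f) a <= (g - f) w by have := fg w; rewrite /= !fctE; lra.
have dE w : 'd (g - f) a w = 'd g a w - 'd f a w by rewrite diffB.
have := derive_ge0_at_min v dh hmin; have := derive_ge0_at_min (- v) dh hmin.
rewrite !dE !linearN -opprD oppr_ge0 => h1 h2.
by apply/esym/eqP; rewrite -subr_eq0 eq_le h1.
Qed.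

Lemma card_le_II_surjection (T : pointedType) (A : set T) (m : nat) :
  (A #<= `I_m)%card -> exists f : 'I_m -> T, forall y, A y -> exists i, f i = y.
Proof.
move=> /pcard_leP[h].
exists (fun i : 'I_m => xget point [set y | A y /\ h y = i :> nat]) => y Ay.
have hm : (h y < m)%N by have := @funS _ _ _ _ h y Ay.
exists (Ordinal hm); case: xgetP => [t _ /= [At ht]|/(_ y)/=]; last by case.
by apply: (@inj _ _ _ h); rewrite ?inE.
Qed.

(** For each such [y], [c (., y) - phi] is minimal at [x], so [c (., y)] and [phi] have the same
    differential there. All these [y] lie in one of the level sets counted by the twist
    condition. *)
Lemma twist_section (R : realType) (n : nat) (X Y : ptopologicalType)
    (S : smooth_atlas R n X) (c : X * Y -> R) (m : nat) (phi : X -> R) (x : X) :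
  m_twist S c m -> emdifferentiable S (EFin \o phi) x ->
  exists f : 'I_m -> Y, forall y,
    (forall x', phi x' <= phi x + c (x', y) - c (x, y)) -> exists i, f i = y.
Proof.
move=> [dc twist] [_ dphi].
have touch y : (forall x', phi x' <= phi x + c (x', y) - c (x, y)) ->
    mdiff S (fun x => c (x, y)) x = mdiff S phi x.
  move=> xy; apply/esym; apply: diff_eq_of_touching.
  - exact: dphi.
  - exact: dc.
  (* The inequality holds on all of [X], hence at [chart_inv] of any [w], even outside the image of
     the chart. *)
  move=> w /=; rewrite chart_mapK ?inE; last exact: chart_at_dom.
  by have := xy (chart_inv (chart_at S x) w); lra.
have [[y0 xy0]|none] := pselect (exists y, forall x', phi x' <= phi x + c (x',
  y) - c (x, y)).
  have [f Hf] := card_le_II_surjection (twist x y0).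
  by exists f => y xy; apply: Hf => /=; rewrite !touch.
by exists (fun=> point) => y xy; exfalso; apply: none; exists y.
Qed.

(** * Borel selections of finite sections *)

(** Tube argument: if [K] has no point above [x] over the compact [F], the same holds for all nearby
    [x']. *)
Lemma closed_projection (X Y : topologicalType) (F : set Y) (K : set (X * Y)) :
  compact F -> closed K -> closed [set x | exists2 y, F y & K (x, y)].
Proof.
move=> /compact_near_coveringP cF; rewrite -openC => oK.
rewrite -openC openE => x nx.
have : \forall x' \near x, F `<=` (fun y => ~ K (x', y)).
  apply: cF => y Fy; have : nbhs (x, y) (~` K).
    by apply: open_nbhs_nbhs; split => // Kxy; apply: nx; exists y.
  move=> [[P Q] /= [Px Qy] PQ].
  by exists (Q, P) => //= -[y' x'] [/= Qy' Px']; exact: (PQ (x', y')).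
by apply: filterS => x' Fx' [y Fy]; exact: Fx'.
Qed.

Section selection.
Context {X Y : ptopologicalType}.
Variables (V : nat -> set Y) (nV : network V) (cV : forall k, closed (V k)).
Hypothesis hY : hausdorff_space Y.
Variables (F : nat -> set Y) (cF : forall n, compact (F n)).
Variables (K : set (X * Y)) (cK : closed K).

(** The selection is built from these projections by countable set operations, so its measurability
    reduces to theirs for [E] closed or open. *)
Let H (E : set Y) : set (borel X) :=
  [set x | exists y, [/\ (\bigcup_n F n) y, E y & K (x, y)]].

Let measurable_H_closed C : closed C -> measurable (H C).
Proof.
move=> cC; rewrite (_ : H C = \bigcup_n
    [set x | exists2 y, F n y & (K `&` [set z | C z.2]) (x, y)]).
  apply: bigcup_measurable => n _; apply: closed_measurable_borel.
  apply: closed_projection => //; apply: closedI => //.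
  by apply: (@closed_comp _ _ (@snd X Y)) => // z _; exact: cvg_snd.
apply/seteqP; split=> x.
  by move=> [y [[n _ Fy] Cy Kxy]]; exists n => //; exists y.
by move=> [n _ [y Fy [Kxy Cy]]]; exists y; split => //; exists n.
Qed.

Let measurable_H_open U : open U -> measurable (H U).
Proof.
move=> oU; rewrite (_ : H U = \bigcup_(k in [set k | V k `<=` U]) H (V k)).
  by apply: bigcup_measurable => k _; exact: measurable_H_closed.
apply/seteqP; split=> x.
  move=> [y [Wy Uy Kxy]]; have [k [Vy kU]] := nV oU Uy.
  by exists k => //; exists y.
by move=> [k kU [y [Wy /kU Uy Kxy]]]; exists y.
Qed.

Variable m : nat.

(* the sets [V (nth 0 t i)], [i < m], isolate the points of the section of [K]
   above [x] *)
Let isolates (t : seq nat) : set (borel X) := [set x |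
  (forall y, (\bigcup_n F n) y -> K (x, y) -> exists i : 'I_m, V (nth 0 t i) y)
    /\
  (forall (i : 'I_m) y y', (\bigcup_n F n) y -> (\bigcup_n F n) y' ->
     K (x, y) -> K (x, y') -> V (nth 0 t i) y -> V (nth 0 t i) y' -> y = y')].

(** Covering fails when the section meets the open complement of a finite union of closed sets.
    Uniqueness fails when, inside one [V (nth 0 t i)], the section meets two disjoint network
    members. *)
Let measurable_isolates t : measurable (isolates t).
Proof.
rewrite (_ : isolates t =
  ~` H (~` \bigcup_(i in [set: 'I_m]) V (nth 0 t i)) `&`
  ~` \bigcup_(i < m) \bigcup_k \bigcup_(l in [set l | V k `&` V l = set0])
       (H (V (nth 0 t i) `&` V k) `&` H (V (nth 0 t i) `&` V l))).
  apply: measurableI; apply: measurableC.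
    apply: measurable_H_open; rewrite openC.
    by apply: closed_bigcup => //; exact: finite_finset.
  apply: bigcup_measurable => i _; apply: bigcup_measurable => k _.
  apply: bigcup_measurable => l _; apply: measurableI;
    by apply: measurable_H_closed; exact: closedI.
apply/seteqP; split=> x.
  move=> [cover uniq]; split.
    by move=> [y [Wy ny Kxy]]; have [i Vy] := cover y Wy Kxy; apply: ny;
      exists i.
  move=> [i im [k _ [l /= kl [[y [Wy [Viy Vky] Kxy]] [y' [Wy' [Viy' Vly']
    Kxy']]]]]].
  have yy' := uniq (Ordinal im) y y' Wy Wy' Kxy Kxy' Viy Viy'.
  have : (V k `&` V l) y by split => //; rewrite yy'.
  by rewrite kl.
move=> [cover uniq]; split.
  move=> y Wy Kxy; apply: contrapT => ny; apply: cover; exists y; split => //.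
  by move=> [i _ Vy]; apply: ny; exists i.
move=> i y y' Wy Wy' Kxy Kxy' Vy Vy'; apply: contrapT => yy'.
have [k [l [Vk Vl kl]]] := network_separates nV hY yy'.
apply: uniq; exists i => //=; exists k => //; exists l => //.
by split; [exists y|exists y'].
Qed.

(** An enumeration of all finite lists; invalid codes give the empty list. [D j] keeps the points
    first isolated at stage [j], so each point uses one list. *)
Let T (j : nat) : seq nat := odflt [::] (unpickle j).
Let D := seqDU (fun j => isolates (T j)).

Let measurable_D j : measurable (D j).
Proof. by apply: measurableD => //; apply: bigsetU_measurable => i _. Qed.

Let select_spec (i : 'I_m) (x : X) : set Y := [set y | exists j,
  [/\ D j x, (\bigcup_n F n) y, V (nth 0 (T j) i) y & K (x, y)]].

Let select (i : 'I_m) (x : X) : Y := xget point (select_spec i x).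

Let D_inj x j j' : D j x -> D j' x -> j = j'.
Proof.
move=> Djx Dj'x; apply: (@trivIset_seqDU _ (fun j => isolates (T j))) => //.
by exists x.
Qed.

Let D_sub j x : D j x -> isolates (T j) x.
Proof. by move=> []. Qed.

Let select_eq i x y : select_spec i x y -> select i x = y.
Proof.
move=> Hy; rewrite /select; case: xgetP => [y' _ Hy'|/(_ y)//].
move: Hy Hy' => [j [Djx Wy Vy Kxy]] [j' [Dj'x Wy' Vy' Kxy']].
move: Dj'x Vy' => /(D_inj Djx) <- Vy'.
have [_ uniq] := D_sub Djx; exact: (uniq i).
Qed.

Let measurable_select i :
  measurable_fun [set: borel X] (select i : borel X -> borel Y).
Proof.
apply: (measurable_fun_network nV) => k.
(* The second set accounts for the default value [point], taken where nothing can be selected. *)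
rewrite (_ : _ @^-1` _ = (\bigcup_j (D j `&` H (V (nth 0 (T j) i) `&` V k))) `|`
   (if `[< V k point >] then ~` \bigcup_j (D j `&` H (V (nth 0 (T j) i))) else
     set0)).
  apply: measurableU.
    apply: bigcup_measurable => j _; apply: measurableI => //.
    by apply: measurable_H_closed; exact: closedI.
  case: ifP => // _; apply: measurableC; apply: bigcup_measurable => j _.
  by apply: measurableI => //; exact: measurable_H_closed.
apply/seteqP; split=> x /=.
  have [[y Hy]|none] := pselect (select_spec i x !=set0).
    rewrite (select_eq Hy) => Vky; left.
    by have [j [Djx Wy Vy Kxy]] := Hy; exists j => //; split => //; exists y.
  rewrite /select; case: xgetP => [y _ Hy|_ Vkp]; first by exfalso;
    apply: none; exists y.
  right; case: asboolP => // _ [j _ [Djx [y [Wy Vy Kxy]]]].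
  by apply: none; exists y, j.
move=> [[j _ [Djx [y [Wy [Vy Vky] Kxy]]]]|].
  by rewrite (@select_eq i x y)//; exists j.
case: asboolP => // Vkp nH; rewrite /select;
  case: xgetP => // y _ [j [Djx Wy Vy Kxy]].
by exfalso; apply: nH; exists j => //; split => //; exists y.
Qed.

(** Each value of [f] has a network member that avoids the finitely many other values. [f] may
    repeat values, hence the condition [f j <> f i]. *)
Let exists_isolates x (f : 'I_m -> Y) :
  (forall y, K (x, y) -> exists i, f i = y) -> exists t, isolates t x.
Proof.
move=> Kf.
have /choice[k Hk] : forall i, exists k, V k (f i) /\
    V k `<=` ~` \bigcup_(j in [set j | f j <> f i]) [set f j].
  move=> i; apply: nV.
    rewrite openC; apply: closed_bigcup; first exact: finite_finset.
    by move=> j _; apply: accessible_closed_set1; exact: hausdorff_accessible.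
  by move=> [j /= ji]; exact: nesym.
exists [seq k i | i <- enum 'I_m].
have tk (i : 'I_m) : nth 0%N [seq k i | i <- enum 'I_m] i = k i.
  by rewrite (nth_map i) ?size_enum_ord// nth_ord_enum.
split=> [y _ /Kf[i <-]|i y y' _ _ /Kf[j <-] /Kf[j' <-]].
  by exists i; rewrite tk; have [] := Hk i.
have kf a : V (k i) (f a) -> f a = f i.
  by move=> /(Hk i).2 nf; apply: contrapT => ai; apply: nf; exists a.
by rewrite tk => /kf -> /kf ->.
Qed.

Lemma finite_section_selection (N : set X) :
  (forall x, ~ N x -> exists f : 'I_m -> Y, forall y, K (x, y) -> exists i, f i
    = y) ->
  exists G : 'I_m -> X -> Y,
    (forall i, measurable_fun [set: borel X] (G i : borel X -> borel Y)) /\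
    (forall x y, ~ N x -> (\bigcup_n F n) y -> K (x, y) -> exists i, G i x = y).
Proof.
move=> finK; exists select; split => // x y Nx Wy Kxy.
have [f Kf] := finK x Nx; have [t tx] := exists_isolates Kf.
have : (\bigcup_j isolates (T j)) x.
  by exists (pickle t) => //; rewrite /T pickleK.
rewrite seqDU_bigcup_eq => -[j _ Djx].
have [cover _] := D_sub Djx; have [i Vy] := cover y Wy Kxy.
by exists i; apply: select_eq; exists j.
Qed.

End selection.

(** * Decomposition along graphs *)

Lemma density_of_dominated (R : realType) (d : measure_display)
    (T : measurableType d) (mu : probability T R) (m : {measure set T -> \bar
      R}) :
  (forall A, measurable A -> (m A <= mu A)%E) ->
  exists a : T -> R, [/\ measurable_fun [set: T] a, forall x, 0 <= a x &
    forall A, measurable A -> m A = (\int[mu]_(x in A) (a x)%:E)%E].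
Proof.
move=> mle.
have [|m' Em'] := finite_measure_intro (m := m).
  by apply: le_lt_trans (mle _ measurableT) _; rewrite probability_setT ltry.
have dom : m' `<< mu.
  apply/null_content_dominatesP => A mA mu0; apply/eqP.
  by rewrite eq_le measure_ge0 andbT Em' -mu0; exact: mle.
have ffin := Radon_Nikodym_SigmaFinite.f_fin_num dom.
exists (fine \o Radon_Nikodym_SigmaFinite.f m' mu); split.
- apply: measurableT_comp; first exact: fine_measurable.
  exact: measurable_int (Radon_Nikodym_SigmaFinite.f_integrable dom).
- by move=> x /=; apply: fine_ge0; exact: Radon_Nikodym_SigmaFinite.f_ge0.
move=> A mA; rewrite -Em' (Radon_Nikodym_SigmaFinite.f_integral dom)//.
by apply: eq_integral => x _ /=; rewrite fineK.
Qed.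

(** On the disjointified graph [D i], belonging to [A] depends on [x] alone, through [(x, G i x)].
    The mass of [gamma] there is thus read off the first marginal of its restriction, which [mu]
    dominates. *)
Lemma graphs_decomposition (R : realType) (X Y : ptopologicalType)
    (V : nat -> set Y) (mu : probability (borel X) R)
    (gamma : probability (borel (X * Y)%type) R) (m : nat)
    (G : 'I_m.+1 -> X -> Y) :
  network V -> (forall k, closed (V k)) -> hausdorff_space Y ->
  (forall A : set (borel X), measurable A -> gamma [set z | A z.1] = mu A) ->
  (forall i, measurable_fun [set: borel X] (G i : borel X -> borel Y)) ->
  gamma.-negligible [set z | forall i, G i z.1 <> z.2] ->
  exists alpha : 'I_m.+1 -> X -> R,
    [/\ forall i, measurable_fun [set: borel X] (alpha i : borel X -> R),
        forall i x, 0 <= alpha i x <= 1,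
        forall A : set (borel (X * Y)%type), measurable A ->
          gamma A = (\sum_(i < m.+1)
            \int[mu]_x (alpha i x * \1_A (x, G i x))%:E)%E &
        {ae mu, forall x, \sum_(i < m.+1) alpha i x = 1}].
Proof.
move=> nV cV hY gmu mG gG.
pose gr (k : nat) : set (borel (X * Y)%type) := [set z | G (inord k) z.1 = z.2].
have mgr k : measurable (gr k) by exact: (measurable_graph nV cV hY).
pose D := seqDU gr.
have mD k : measurable (D k).
  by apply: measurableD => //; apply: bigsetU_measurable => i _.
have mpair i : measurable_fun [set: borel X]
    ((fun x => (x, G i x)) : borel X -> borel (X * Y)%type).
  by apply: (measurable_fun_pair_borel nV cV) => //; exact: measurable_id.
have mpre (A : set (borel (X * Y)%type)) i : measurable A ->
    measurable ([set x | A (x, G i x)] : set (borel X)).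
  by move=> mA; rewrite -[X in measurable X]setTI; exact: mpair.
have gD (A : set (borel (X * Y)%type)) : measurable A ->
    gamma A = (\sum_(i < m.+1) gamma (A `&` D i))%E.
  move=> mA.
  have gsum : (gamma (\big[setU/set0]_(i < m.+1) (A `&` D i)) =
      \sum_(i < m.+1) gamma (A `&` D i))%E.
    apply: (@measure_semi_additive _ _ _ gamma (fun k => A `&` D k)).
    - by move=> k; exact: measurableI.
    - by apply: trivIset_setIl; exact: trivIset_seqDU.
    - by apply: bigsetU_measurable => i _; exact: measurableI.
  rewrite -gsum; set U := \big[setU/set0]_(i < m.+1) _.
  have mU : measurable U by apply: bigsetU_measurable => i _;
    exact: measurableI.
  have UA : U `<=` A.
    by rewrite /U -(bigcup_mkord m.+1 (fun i => A `&` D i)) => z [i _ []].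
  have A0 : gamma (A `\` U) = 0%E.
    apply/negligibleP; first exact: measurableD.
    apply: negligibleS gG => z [Az nU] i Gi; apply: nU.
    have : (\big[setU/set0]_(k < m.+1) gr k) z.
      rewrite -(bigcup_mkord m.+1 gr); exists i; first exact: ltn_ord.
      by rewrite /gr /= inord_val.
    rewrite bigsetU_seqDU -(bigcup_mkord m.+1 (seqDU gr)) => -[k km Dk].
    by rewrite /U -(bigcup_mkord m.+1 (fun i => A `&` D i)); exists k.
  by rewrite (measureDI gamma mA mU) [X in (X + _)%E]A0 add0e setIidr.
have /choice[a Ha] : forall i : 'I_m.+1, exists a : borel X -> R,
    [/\ measurable_fun [set: borel X] a, forall x, 0 <= a x &
    forall A : set (borel X), measurable A ->
      gamma ([set z | A z.1] `&` D i) = (\int[mu]_(x in A) (a x)%:E)%E].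
  move=> i.
  have [mi Emi] := measure_pushforward (mrestr gamma (mD i))
    (@measurable_fst_borel X Y).
  have [|a [ma a0 aE]] := @density_of_dominated R _ _ mu mi.
    move=> A mA; rewrite Emi -gmu//; apply: le_measure; rewrite ?inE.
    - by apply: measurableI => //; exact: measurable_fst_preimage.
    - exact: measurable_fst_preimage.
    - by move=> z [].
  by exists a; split => // A mA; rewrite -aE// Emi.
have ma i : measurable_fun [set: borel X] (a i) by have [] := Ha i.
have a0 i x : 0 <= a i x by have [_ + _] := Ha i; exact.
(* Over any Borel [E], the densities integrate in total to [gamma] of the cylinder above [E], that
   is [mu E]. *)
have sum1 : ae_eq mu setT (fun x => (\sum_(i < m.+1) (a i x)%:E)%E) (cst 1%E).
  apply/ae_eq_sym/integral_ae_eq => //.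
  - exact: finite_measure_integrable_cst.
  - by apply: emeasurable_sum => i; exact/measurable_EFinP.
  move=> E _ mE; rewrite integral_cst// mul1e ge0_integral_sum//.
  - apply: (etrans (esym (gmu E mE))).
    rewrite gD; last exact: measurable_fst_preimage.
    by apply: eq_bigr => i _; have [_ _ ->] := Ha i.
  - by move=> i; apply/measurable_funTS/measurable_EFinP.
  - by move=> i x _; rewrite lee_fin.
(* The densities are at most 1 only almost everywhere; truncation makes the bound hold
   everywhere. *)
pose alpha i x := Num.min (a i x) 1.
have malpha i : measurable_fun [set: borel X] (alpha i : borel X -> R).
  by apply: measurable_minr => //; exact: measurable_cst.
have aealpha : {ae mu, forall x, \sum_(i < m.+1) alpha i x = 1 /\ forall i,
  alpha i x = a i x}.
  apply: filterS sum1 => x /(_ I); rewrite sumEFin => -[s1].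
  have ale i : a i x <= 1.
    by rewrite -s1 (bigD1 i)//= lerDl sumr_ge0.
  have E i : alpha i x = a i x by rewrite /alpha min_l.
  by split=> //; rewrite -s1; apply: eq_bigr => i _; exact: E.
exists alpha; split => //.
- move=> i x; rewrite /alpha ge_min lexx orbT andbT le_min a0 ler01//.
- move=> A mA; rewrite gD//; apply: eq_bigr => i _.
  have mB := mpre A i mA.
  transitivity (gamma ([set z | A (z.1, G i z.1)] `&` D i)).
    congr (gamma _); apply/seteqP; split=> -[x y] [/= Axy Dxy]; split => //=;
      by have : gr i (x, y) by [case: Dxy]; rewrite /gr /= inord_val => Gxy;
        rewrite ?Gxy// -?Gxy.
  have [_ _ aE] := Ha i; rewrite (aE _ mB) integral_mkcond.
  apply: ae_eq_integral => //.
  - apply/(measurable_restrictT (fun x => (a i x)%:E) mB)/measurable_funTS.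
    exact/measurable_EFinP.
  - apply/measurable_EFinP; apply: measurable_funM => //.
    by apply: (measurableT_comp _ (mpair i)); exact: measurable_indic.
  - apply: filterS aealpha => x [_ aa] _; rewrite /patch /= aa indicE.
    case: ifPn => [/set_mem Ax|]; first by rewrite mem_set// mulr1.
    by rewrite notin_setE => Ax; rewrite memNset// mulr0.
- by apply: filterS aealpha => x [].
Qed.

(** * Decomposition of optimal plans under the twist condition *)

Theorem theorem1p3 (R : realType) (n : nat) (X Y : ptopologicalType)
    (S : smooth_atlas R n X) (g : riemannian_metric S)
    (hX : complete_separable_riemannian g) (hY : polish_space R Y)
    (mu : probability (borel X) R) (nu : probability (borel Y) R)
    (c : X * Y -> R) (hc : continuous c)
    (hb : exists B : R, forall z, `|c z| <= B)
    (m : nat)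
    (htwist : m_twist S c m)
    (hatom : non_atomic mu)
    (hdiff : forall phi : X -> \bar R, c_concave c phi ->
       {ae mu, forall x, phi x \is a fin_num -> emdifferentiable S phi x})
    (gamma : probability (borel (X * Y)%type) R)
    (hgamma : optimal_plan c mu nu gamma) :
  exists k : nat, (1 <= k <= m)%N /\
  exists (alpha : 'I_k -> X -> R) (G : 'I_k -> X -> Y),
    [/\ forall i, measurable_fun [set: borel X] (alpha i : borel X -> R),
        forall i x, 0 <= alpha i x <= 1,
        forall i, measurable_fun [set: borel X] (G i : borel X -> borel Y),
        forall A : set (borel (X * Y)%type), measurable A ->
          gamma A = (\sum_(i < k)
            \int[mu]_x (alpha i x * \1_A (x, G i x))%:E)%E &
        {ae mu, forall x, \sum_(i < k) alpha i x = 1}].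
Proof.
have [sY [d [dm dtop _]]] := hY; have [B cB] := hb.
have hausY := metrizable_hausdorff dm dtop.
have [V [cV nV]] := separable_closed_network dm dtop sY.
have [D [mD D0 cmD]] := optimal_concentrated nV cV hc cB hgamma.
have [gfst gsnd] := hgamma.1.
have Dne : D !=set0.
  apply/set0P/negP => /eqP DE; move: D0; rewrite DE setC0.
  by move=> /esym/eqP; rewrite (probability_setT gamma) eqe eq_sym oner_eq0.
have [phi [L [phi_le phi_inf phiD]]] := cyclically_monotone_potential cB cmD
  Dne.
have [N [mN N0 dphiN]] := hdiff _ (potential_c_concave phi_le phi_inf).
pose K := [set z | forall x', phi x' <= phi z.1 + c (x', z.2) - c z].
have cK : closed K := c_superdifferential_closed phi_le phi_inf hc.
have [F [cF W0]] := probability_tight nu hY.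
have finK x : ~ N x ->
    exists f : 'I_m -> Y, forall y, K (x, y) -> exists i, f i = y.
  move=> Nx; apply: twist_section htwist _; apply: contrapT => ndiff; apply: Nx.
  by apply: dphiN => /= /(_ isT).
have [G [mG GK]] := finite_section_selection nV cV hausY cF cK finK.
(* The level set of the twist condition at [point] contains [point], so [m] is positive and [k = m]
   is admissible. *)
have m0 : (0 < m)%N.
  have [f /(_ point erefl)[i _]] := card_le_II_surjection (htwist.2 point
    point).
  exact: leq_ltn_trans (leq0n i) (ltn_ord i).
move: {finK htwist} m m0 G mG GK => [//|m] _ G mG GK.
(* Three null sets suffice: the complement of [D], the points above [N], and those whose second
   coordinate leaves the sigma-compact set. *)
have neg : gamma.-negligible [set z | forall i, G i z.1 <> z.2].
  apply: (@negligibleS _ _ _ _ (~` D `|` ([set z | N z.1] `|` [set z | (~`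
    \bigcup_n F n) z.2]))).
    move=> [x y] /= nG; apply: contrapT => /not_orP[/contrapT Dxy /not_orP[Nx
      /contrapT Wy]].
    have [i Gi] := GK x y Nx Wy (fun x' => phiD x y x' Dxy).
    exact: nG i Gi.
  have mW : measurable (~` \bigcup_n F n : set (borel Y)).
    apply: measurableC; apply: bigcup_measurable => n' _.
    by apply: closed_measurable_borel; exact: compact_closed (cF n').
  apply: negligibleU; last apply: negligibleU.
  - by apply/negligibleP => //; exact: measurableC.
  - apply/negligibleP; first exact: measurable_fst_preimage.
    exact: etrans (gfst _ mN) N0.
  - apply/negligibleP; first exact: measurable_snd_preimage.
    exact: etrans (gsnd _ mW) W0.
have [alpha [malpha alpha01 galpha sum1]] := graphs_decomposition nV cV hausY
  gfst mG neg.
by exists m.+1; split; [rewrite /= leqnn|exists alpha, G; split].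
Qed.
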